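(* Let $\mathcal X,\mathcal Y,\mathcal S,\mathcal J$ be finite sets, let $P_S$ be a probability distribution on $\mathcal S$ with $P_S(s)>0$ for all $s\in\mathcal S$, and let $W_{Y|X,S,J}$ be a channel (conditional distribution) from $\mathcal X\times\mathcal S\times\mathcal J$ to $\mathcal Y$. The capacity (randomized coding capacity under the maximum probability of error criterion) of the Gel'fand-Pinsker AVC given by $(P_S,W_{Y|X,S,J})$ is $$C=\max_{P_{U|S},\,x(\cdot,\cdot)}\ \min_{Q_{J|S}}\ \bigl(I(U;Y)-I(U;S)\bigr),$$ where the maximum is over conditional distributions $P_{U|S}\in\mathcal P(\mathcal U|\mathcal S)$ and functions $x:\mathcal U\times\mathcal S\to\mathcal X$, with $\mathcal U$ an alphabet satisfying $|\mathcal U|\le|\mathcal X|^{|\mathcal S|}$, the minimum is over $Q_{J|S}\in\mathcal P(\mathcal J|\mathcal S)$, and the mutual informations are evaluated under the joint distribution $P_S(s)\,P_{U|S}(u|s)\,Q_{J|S}(j|s)\,\mathbf 1\{x=x(u,s)\}\,W_{Y|X,S,J}(y|x,s,j)$.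
   Context: $\mathcal P(\mathcal A|\mathcal B)$ denotes the set of all conditional distributions on $\mathcal A$ given an element of $\mathcal B$. All logarithms are base 2. Gel'fand-Pinsker AVC (GP-AVC). Over $n$ channel uses the state vector $\mathbf S=(S_1,\dots,S_n)$ is i.i.d. with distribution $P_S$, independent of the message $M$ and of the shared randomness. Given encoder input $\mathbf x\in\mathcal X^n$, state $\mathbf s\in\mathcal S^n$ and jamming vector $\mathbf j\in\mathcal J^n$, the output is $\mathbf y\in\mathcal Y^n$ with probability $\prod_{i=1}^n W_{Y|X,S,J}(y_i|x_i,s_i,j_i)$. An $(n,R)$ deterministic code ($2^{nR}$ an integer) is a pair $(\psi,\phi)$ with encoder $\psi:\{1,\dots,2^{nR}\}\times\mathcal S^n\to\mathcal X^n$ and decoder $\phi:\mathcal Y^n\to\{0,1,\dots,2^{nR}\}$ (output $0$ means an error is declared). An $(n,R)$ randomized code is a random variable $\Theta=(\Psi,\Phi)$ taking values in the set of $(n,R)$ deterministic codes; it is shared by encoder and decoder. The transmitted vector is $\mathbf X=\Psi(M,\mathbf S)$. The adversary knows $M$, $\mathbf S$ (non-causally) and the distribution of $\Theta$, but not the realization of $\Theta$: it chooses $\mathbf J$ according to an arbitrary conditional distribution $Q_{\mathbf J|M,\mathbf S}$, with $\mathbf J$ conditionally independent of $\Theta$ given $(M,\mathbf S)$. The maximum probability of error of the randomized code is $$P_e^{(n)}=\max_m\ \max_{Q_{\mathbf J|M=m,\mathbf S}}\ \mathbb P(\Phi(\mathbf Y)\ne m\mid M=m),$$ the probability being over $\mathbf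 S$, $\mathbf J$, the channel and $\Theta$. A rate $R$ is achievable if for every $\epsilon>0$ there is an $(n,R)$ randomized code for some $n$ with $P_e^{(n)}<\epsilon$. The capacity is the supremum of all achievable rates. *)

(* Defs.v *)
From mathcomp Require Import all_boot all_order all_algebra.
From mathcomp Require Import all_classical all_reals all_analysis.

Set Implicit Arguments.
Unset Strict Implicit.
Unset Printing Implicit Defensive.

Import Order.TTheory GRing.Theory Num.Theory.
Local Open Scope classical_set_scope.
Local Open Scope ring_scope.

Definition is_maximum {R : realType} (E : set R) (v : R) : Prop :=
  E v /\ ubound E v.

Definition is_minimum {R : realType} (E : set R) (v : R) : Prop :=
  E v /\ lbound E v.

(* [v = max_a min_(b in D) f a b], where every inner minimum and the outer
   maximum are required to be attained. *)
Definition is_maxmin {R : realType} {A B : Type} (D : set B) (f : A -> B -> R)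
    (v : R) : Prop :=
  (forall a, exists m, is_minimum (f a @` D) m) /\
  is_maximum [set m | exists a, is_minimum (f a @` D) m] v.

Definition is_pmf {R : realType} {T : finType} (p : T -> R) : Prop :=
  (forall t, 0 <= p t) /\ \sum_t p t = 1.

(* Conditional distributions on [T] given an element of [B]: [W b t] is the
   probability of [t] given [b]. *)
Definition is_cond_pmf {R : realType} {B : Type} {T : finType}
    (W : B -> T -> R) : Prop :=
  forall b, is_pmf (W b).

(* The law of the random variable [f] on the finite probability space
   [(T, p)]. *)
Definition law {R : realType} {T A : finType} (p : T -> R) (f : T -> A)
    (a : A) : R :=
  \sum_(t | f t == a) p t.

Definition log2 {R : realType} (x : R) : R := ln x / ln 2.

(* Terms of probability zero vanish whatever the value of [log2] there, which
   is the usual convention [0 log 0 = 0]. *)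
Definition mutual_info {R : realType} {T A B : finType} (p : T -> R)
    (f : T -> A) (g : T -> B) : R :=
  \sum_a \sum_b
    let pab := law p (fun t => (f t, g t)) (a, b) in
    pab * log2 (pab / (law p f a * law p g b)).

Section Coding.
Context {R : realType} {X Y S J : finType}.
Implicit Types (PS : S -> R) (W : X * S * J -> Y -> R).

Definition word (n : nat) (A : finType) : finType := {ffun 'I_n -> A}.

Definition encoder (n N : nat) : finType :=
  {ffun 'I_N * word n S -> word n X}.

(* [None] is the declaration of an error. *)
Definition decoder (n N : nat) : finType :=
  {ffun word n Y -> option 'I_N}.

Definition code (n N : nat) : finType := (encoder n N * decoder n N)%type.

Definition iid PS n (s : word n S) : R := \prod_i PS (s i).

Definition memoryless W n (x : word n X) (s : word n S) (j : word n J)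
    (y : word n Y) : R :=
  \prod_i W (x i, s i, j i) (y i).

(* Joint law of [(Theta, S^n, J^n, Y^n)] given that the message is [m].  The
   set of codes being finite, a randomized code is given by its law [PTheta].
   The jammer's law [Q] sees the state vector (and the message, [Q] being
   chosen after [m]) but not the realization of the code. *)
Definition transmission PS W n N (PTheta : code n N -> R) (m : 'I_N)
    (Q : word n S -> word n J -> R)
    (w : code n N * word n S * word n J * word n Y) : R :=
  let: (theta, s, j, y) := w in
  PTheta theta * iid PS s * Q s j * memoryless W (theta.1 (m, s)) s j y.

Definition error_prob PS W n N (PTheta : code n N -> R) (m : 'I_N)
    (Q : word n S -> word n J -> R) : R :=
  \sum_(w : code n N * word n S * word n J * word n Y |
        let: (theta, s, j, y) := w in theta.2 y != Some m)
    transmission PS W PTheta m Q w.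

(* For [0 < N] and [J] nonempty this supremum is a maximum: [error_prob] is
   affine in [Q], which ranges over a product of simplices. *)
Definition max_error_prob PS W n N (PTheta : code n N -> R) : R :=
  sup [set e | exists (m : 'I_N) (Q : word n S -> word n J -> R),
         is_cond_pmf Q /\ e = error_prob PS W PTheta m Q].

(* The block length must be positive: with [n = 0] the trivial one-message
   code would make every rate achievable. *)
Definition achievable PS W (r : R) : Prop :=
  forall eps : R, 0 < eps ->
    exists (n N : nat) (PTheta : code n N -> R),
      [/\ (0 < n)%N, N%:R = 2 `^ (n%:R * r), is_pmf PTheta &
          max_error_prob PS W PTheta < eps].

Definition is_capacity PS W (C : R) : Prop :=
  supremums [set r | achievable PS W r] C.

End Coding.

(* The pairs [(P_(U|S), x)] over which one maximizes. *)
Record gp_input (R : realType) (X S : finType) := GPInput {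
  aux : finType;
  aux_card : (#|aux| <= #|X| ^ #|S|)%N;
  aux_law : S -> aux -> R;
  aux_lawP : is_cond_pmf aux_law;
  input_map : aux -> S -> X
}.

Arguments aux {R X S} c : rename.
Arguments aux_law {R X S} c s u : rename.
Arguments input_map {R X S} c u s : rename.

Section Information.
Context {R : realType} {X Y S J : finType}.

Definition gp_joint (PS : S -> R) (W : X * S * J -> Y -> R)
    (c : gp_input R X S) (Q : S -> J -> R)
    (w : aux c * S * J * X * Y) : R :=
  let: (u, s, j, x, y) := w in
  PS s * aux_law c s u * Q s j * (x == input_map c u s)%:R * W (x, s, j) y.

Definition gp_rate (PS : S -> R) (W : X * S * J -> Y -> R)
    (c : gp_input R X S) (Q : S -> J -> R) : R :=
  let p := @gp_joint PS W c Q in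
  let U (w : aux c * S * J * X * Y) := w.1.1.1.1 in
  let St (w : aux c * S * J * X * Y) := w.1.1.1.2 in
  let Yt (w : aux c * S * J * X * Y) := w.2 in
  mutual_info p U Yt - mutual_info p U St.

End Information.

(* Main.v *)
Require Import Defs.
From mathcomp Require Import all_boot all_order all_algebra.
From mathcomp Require Import all_classical all_reals all_analysis.
From mathcomp Require Import ring lra.

Set Implicit Arguments.
Unset Strict Implicit.
Unset Printing Implicit Defensive.

Import Order.TTheory GRing.Theory Num.Theory.
Import numFieldNormedType.Exports.
Local Open Scope classical_set_scope.
Local Open Scope ring_scope.

(** Achievability. Fix [(P_(U|S), x)]. For each message and each of
    [L ~ K 2^(n I(U;S))] indices draw a codeword from [P_U^n], and let it be
    accepted, given [s], with probability proportional to [P(u|s) / P(u)]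
    (truncated); the encoder uses any accepted codeword, which then behaves as
    if drawn from [P(u|s)], and none is accepted with probability about
    [1 / K]. The decoder thresholds [prod_k W*(y_k|u_k) / P*(y_k)], where [W*]
    is induced by a jammer minimizing [I(U;Y)]. By first-order optimality this
    metric has mean at least [min_Q I(U;Y)] under every jamming strategy, so
    Chebyshev's inequality suffices for the correct codeword, while Markov's
    inequality bounds a wrong one. Mixing a little uniform jamming into the
    minimization keeps the densities positive.

    Converse. Put [V = (M, Theta)] and [U_i = (V, Y^(i-1), S_(i+1)^n)]. The law
    of [(U_i, S_i, X_i)] only depends on the jamming of the letters before [i],
    so the jammer can pick its letters one after the other, each minimizing
    [I(U_i;Y_i) - I(U_i;S_i)], and no minimax theorem is needed. The sum over
    [i] telescopes, and replacing [U] by a strategy [S -> X], which gives the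
    cardinality bound, never decreases [I(U;Y) - I(U;S)]. *)

(** Shared randomness keeps achievability elementary: for fixed state and jamming vectors the
    average over books is taken first, so a bound on it holds against every noncausal jammer and
    nothing is derandomized. The law of the transmitted codeword is never computed: its failure is
    bounded by a sum over all accepted codewords, on average at most [K + 1] of them. Apart from the
    [1 / K] term, all errors are [O(1 / n)]. A jammer minimizing [I(U;Y)] may exclude pairs [(u, y)]
    that another jammer produces; there the logarithm of the metric would be uncontrolled, and this
    obstacle calls for the uniform component. In the converse [X_i] depends on past states, which
    [U_i] omits, so it is not a function of [(U_i, S_i)]. The reduction to strategies is therefore
    stated for arbitrary laws of [(U, S, X)]. It also moves the maximization to a single compact set
    of kernels. Finally [2^(nR)] must be an integer, which restricts achievable rates to a countable
    set; its density is enough for the supremum. *)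

(** The tangent bound [ln r <= r - 1]. Positivity of [r] is asked only on the support of [p],
    because [r] will be a ratio of laws that may vanish elsewhere. *)
Lemma gibbs (R : realType) (T : finType) (p r : T -> R) :
  (forall t, 0 <= p t) -> (forall t, 0 < p t -> 0 < r t) ->
  \sum_t p t * r t <= \sum_t p t -> \sum_t p t * ln (r t) <= 0.
Proof.
move=> p0 r0 pr; apply: (@le_trans _ _ (\sum_t (p t * r t - p t))).
  apply: ler_sum => t _; have := p0 t; rewrite le_eqVlt => /predU1P[<- | pt].
    by rewrite !mul0r subr0.
  rewrite -[X in _ - X]mulr1 -mulrBr ler_pM2l// -[X in ln X](subrK 1) addrC.
  by rewrite le_ln1Dx// ltrBrDl addrN r0.
by rewrite sumrB subr_le0.
Qed.

(** * Product laws on words and Chebyshev's inequality *)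

Section ProductWeights.
Context {R : realType} {I A : finType}.
Implicit Types (p : I -> A -> R) (w : {ffun I -> A}).

(** Invariance under [update _ i] is how later statements express that a function ignores coordinate
    [i]. *)
Definition update w (i : I) (b : A) : {ffun I -> A} :=
  [ffun k => if k == i then b else w k].

Lemma update_same w i b : update w i b i = b.
Proof. by rewrite ffunE eqxx. Qed.

Lemma update_other w i b k : k != i -> update w i b k = w k.
Proof. by move=> ki; rewrite ffunE (negbTE ki). Qed.

Lemma updateK w i b : update (update w i b) i (w i) = w.
Proof. by apply/ffunP => k; rewrite !ffunE; case: eqP => // ->. Qed.

Definition prodw p w : R := \prod_i p i (w i).

Lemma prodw_ge0 p w : (forall i a, 0 <= p i a) -> 0 <= prodw p w.
Proof. by move=> p0; apply: prodr_ge0. Qed.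

Lemma sum_prodw p : \sum_w prodw p w = \prod_i \sum_a p i a.
Proof. by rewrite bigA_distr_bigA. Qed.

Lemma sum_prodw1 p : (forall i, is_pmf (p i)) -> \sum_w prodw p w = 1.
Proof.
by move=> hp; rewrite sum_prodw big1// => i _; have [] := hp i.
Qed.

Lemma is_pmf_prodw p : (forall i, is_pmf (p i)) -> is_pmf (prodw p).
Proof.
move=> hp; split; last exact: sum_prodw1.
by move=> w; apply: prodw_ge0 => i a; have [] := hp i.
Qed.

(* Reindex the pairs [(w, b)] by the involution exchanging [w i] and [b]. *)
Lemma prodw_coord p p' i (F : {ffun I -> A} -> R) (g : A -> R) :
  (forall k, k != i -> p' k = p k) -> \sum_b p i b = 1 ->
  (forall w b, F (update w i b) = F w) ->
  \sum_w prodw p' w * (F w * g (w i)) =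
  (\sum_w prodw p w * F w) * (\sum_b p' i b * g b).
Proof.
move=> pp pi1 hF; rewrite big_distrlr/= pair_bigA/=.
pose h (z : {ffun I -> A} * A) := (update z.1 i z.2, z.1 i).
rewrite (reindex_inj (h := h)); last first.
  apply: (can_inj (g := h)) => -[w b]; rewrite /h/= update_same.
  by rewrite updateK.
rewrite -(pair_bigA _ (fun w b => prodw p (update w i b) *
   F (update w i b) * (p' i (w i) * g (w i))))/=.
apply: eq_bigr => w _; rewrite -[LHS]mul1r -pi1 mulr_suml.
apply: eq_bigr => b _; rewrite hF /prodw (bigD1 i)//= [in RHS](bigD1 i)//=.
rewrite update_same (eq_bigr (fun k => p k (w k))); last first.
  by move=> k ki; rewrite pp.
rewrite [in RHS](eq_bigr (fun k => p k (w k))); last first.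
  by move=> k ki; rewrite update_other.
by ring.
Qed.

Lemma prodw_change p p' i (F : {ffun I -> A} -> R) :
  (forall k, k != i -> p' k = p k) -> \sum_b p i b = 1 -> \sum_b p' i b = 1 ->
  (forall w b, F (update w i b) = F w) ->
  \sum_w prodw p' w * F w = \sum_w prodw p w * F w.
Proof.
move=> pp p1 p1' hF; have := prodw_coord (fun=> 1) pp p1 hF.
rewrite (eq_bigr (fun w => prodw p' w * F w)) => [->|w _]; last by rewrite mulr1.
by rewrite (eq_bigr (p' i)) ?p1' ?mulr1// => b _; rewrite mulr1.
Qed.

Lemma prodw_indep p i (F : {ffun I -> A} -> R) (g : A -> R) :
  \sum_b p i b = 1 -> (forall w b, F (update w i b) = F w) ->
  \sum_w prodw p w * (F w * g (w i)) =
  (\sum_w prodw p w * F w) * (\sum_b p i b * g b).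
Proof. by move=> p1 hF; apply: prodw_coord. Qed.

Lemma prodw_marginal p i (g : A -> R) : (forall k, \sum_b p k b = 1) ->
  \sum_w prodw p w * g (w i) = \sum_b p i b * g b.
Proof.
move=> p1; have := prodw_indep (i := i) (F := fun=> 1) g (p1 i) (fun _ _ => erefl).
rewrite (eq_bigr (fun w => prodw p w * g (w i))) => [->|w _]; last first.
  by rewrite mul1r.
rewrite (eq_bigr (prodw p)) => [|w _]; last by rewrite mulr1.
by rewrite sum_prodw big1 ?mul1r.
Qed.

End ProductWeights.

(** The letter laws may differ: once the state and jamming vectors are fixed, as in [metric_tail],
    the letters are independent but not identically distributed. *)
Lemma chebyshev_prodw (R : realType) (A : finType) (n : nat)
    (p f : 'I_n -> A -> R) (M d : R) :
  (0 < n)%N -> 0 < d -> (forall k, is_pmf (p k)) ->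
  (forall k a, `|f k a| <= M) ->
  \sum_(w : {ffun 'I_n -> A} |
      \sum_k f k (w k) <= \sum_k \sum_a p k a * f k a - n%:R * d) prodw p w
  <= M ^+ 2 / (n%:R * d ^+ 2).
Proof.
move=> n0 d0 hp hf.
have p0 k a : 0 <= p k a by have [] := hp k.
have p1 k : \sum_a p k a = 1 by have [] := hp k.
pose mu k := \sum_a p k a * f k a.
pose g k a := f k a - mu k.
have g0 k : \sum_a p k a * g k a = 0.
  by under eq_bigr do rewrite mulrBr; rewrite sumrB -mulr_suml p1 mul1r subrr.
have nd : 0 < n%:R * d by rewrite mulr_gt0// ltr0n.
have var k : \sum_a p k a * g k a ^+ 2 <= M ^+ 2.
  apply: (@le_trans _ _ (\sum_a p k a * f k a ^+ 2)).
    rewrite (_ : \sum_a p k a * g k a ^+ 2 =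
        \sum_a p k a * f k a ^+ 2 - mu k ^+ 2).
      by rewrite gerBl sqr_ge0.
    transitivity (\sum_a (p k a * f k a ^+ 2 - mu k * (p k a * f k a)
        - mu k * (p k a * g k a))).
      by apply: eq_bigr => a _; rewrite /g; ring.
    by rewrite !sumrB -!mulr_sumr g0 mulr0 subr0 expr2.
  rewrite -[leRHS]mul1r -(p1 k) mulr_suml; apply: ler_sum => a _.
  apply: ler_wpM2l => //; rewrite -[f k a ^+ 2]real_normK ?num_real//.
  by rewrite lerXn2r ?nnegrE// (le_trans _ (hf k a)).
pose Z (w : {ffun 'I_n -> A}) := \sum_k g k (w k).
have EZ : \sum_w prodw p w * Z w ^+ 2 <= n%:R * M ^+ 2.
  have -> : \sum_w prodw p w * Z w ^+ 2 =
      \sum_k \sum_l \sum_w prodw p w * (g l (w l) * g k (w k)).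
    under eq_bigr do rewrite expr2 big_distrlr/= mulr_sumr.
    rewrite exchange_big; apply: eq_bigr => k _/=.
    under eq_bigr do rewrite mulr_sumr.
    rewrite exchange_big; apply: eq_bigr => l _/=.
    by apply: eq_bigr => w _; rewrite [g k _ * _]mulrC.
  apply: (@le_trans _ _ (\sum_(k < n) M ^+ 2)); last first.
    by rewrite sumr_const card_ord mulr_natl.
  apply: ler_sum => k _; rewrite (bigD1 k)//= [X in _ + X]big1 ?addr0.
    by rewrite (prodw_marginal (p := p) k (fun a => g k a * g k a)) //.
  (* Off the diagonal, independence and a centred factor make the covariance vanish. *)
  move=> l lk.
  rewrite (@prodw_indep _ _ _ p k (fun w => g l (w l)))// ?g0 ?mulr0// => w b.
  by rewrite update_other.
apply: (@le_trans _ _ (\sum_w prodw p w * (Z w ^+ 2 / (n%:R * d) ^+ 2))).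
  rewrite big_mkcond; apply: ler_sum => w _; have := prodw_ge0 w p0.
  case: ifP => [H pw|_ pw].
    rewrite ler_peMr// ler_pdivlMr ?exprn_gt0// mul1r.
    have ndZ : n%:R * d <= - Z w.
      by rewrite /Z /g sumrB opprB lerBrDr addrC -lerBrDr.
    rewrite -[Z w ^+ 2]sqrrN lerXn2r ?nnegrE ?(ltW nd)//.
    exact: ltW (lt_le_trans nd ndZ).
  by rewrite mulr_ge0// divr_ge0 ?sqr_ge0.
under eq_bigr do rewrite mulrA.
rewrite -mulr_suml ler_pdivrMr ?exprn_gt0//; apply: (le_trans EZ).
have n0' : n%:R != 0 :> R by rewrite pnatr_eq0 -lt0n.
rewrite le_eqVlt; apply/orP; left; apply/eqP; field.
by rewrite n0' gt_eqF.
Qed.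

(** * Information quantities as finite sums *)

Section Laws.
Context {R : realType} {T : finType} (p : T -> R).
Hypothesis p0 : forall t, 0 <= p t.

Lemma lawE (A : finType) (f : T -> A) a :
  law p f a = \sum_t p t * (f t == a)%:R.
Proof.
rewrite /law big_mkcond; apply: eq_bigr => t _.
by case: eqP; rewrite (mulr1, mulr0).
Qed.

Lemma sum_law (A : finType) (f : T -> A) (G : A -> R) :
  \sum_t p t * G (f t) = \sum_a law p f a * G a.
Proof.
rewrite (partition_big f xpredT)//=; apply: eq_bigr => a _.
by rewrite /law mulr_suml; apply: eq_bigr => t /eqP ->.
Qed.

Lemma law_ge0 (A : finType) (f : T -> A) a : 0 <= law p f a.
Proof. exact: sumr_ge0. Qed.

Lemma law_gt0 (A : finType) (f : T -> A) t : 0 < p t -> 0 < law p f (f t).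
Proof.
by move=> pt; rewrite /law (bigD1 t)//= ltr_wpDr// sumr_ge0.
Qed.

Lemma sum_lawT (A : finType) (f : T -> A) : \sum_a law p f a = \sum_t p t.
Proof.
have := sum_law f (fun=> 1); under eq_bigr do rewrite mulr1.
by under [in X in _ = X -> _]eq_bigr do rewrite mulr1.
Qed.

Lemma mutual_infoE (A B : finType) (f : T -> A) (g : T -> B) :
  mutual_info p f g =
  (\sum_t p t * (ln (law p (fun t => (f t, g t)) (f t, g t))
     - ln (law p f (f t)) - ln (law p g (g t)))) / ln 2.
Proof.
rewrite /mutual_info pair_bigA/=.
have := sum_law (fun t => (f t, g t)) (fun ab =>
  log2 (law p (fun t => (f t, g t)) ab / (law p f ab.1 * law p g ab.2))).
move=> /= E; rewrite (eq_bigr (fun ab => law p (fun t => (f t, g t)) ab *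
  log2 (law p (fun t => (f t, g t)) ab / (law p f ab.1 * law p g ab.2)))).
  rewrite -E mulr_suml; apply: eq_bigr => t _.
  have := p0 t; rewrite le_eqVlt => /predU1P[<- | pt]; first by rewrite !mul0r.
  rewrite /log2 mulrA ln_div ?posrE ?mulr_gt0 ?law_gt0//.
  by rewrite lnM ?posrE ?law_gt0// opprD addrA.
by case.
Qed.

End Laws.

(** [ln] is [0] on nonpositive reals, hence so is [xlnx]: this encodes [0 ln 0 = 0] and gives a
    function continuous on the whole line. *)
Definition xlnx {R : realType} (x : R) : R := x * ln x.

(* When [a] and [b] are the joint laws of [(U, S)] and [(U, Y)], this is
   [I(U;Y) - I(U;S)] in nats: the entropies of [U] cancel. *)
Definition info_gap {R : realType} {U S Y : finType}
    (a : U -> S -> R) (b : U -> Y -> R) : R :=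
  \sum_u \sum_y xlnx (b u y) - \sum_y xlnx (\sum_u b u y)
  - \sum_u \sum_s xlnx (a u s) + \sum_s xlnx (\sum_u a u s).

Section GPRate.
Context {R : realType} {X Y S J : finType}.
Variables (PS : S -> R) (W : X * S * J -> Y -> R).
Hypotheses (hPS : is_pmf PS) (hW : is_cond_pmf W).

Definition averaged (Q : S -> J -> R) (x : X) (s : S) (y : Y) : R :=
  \sum_j Q s j * W (x, s, j) y.

Lemma averaged_pmf Q x s : is_cond_pmf Q -> is_pmf (averaged Q x s).
Proof.
move=> hQ; have [Q0 Q1] := hQ s; split=> [y|].
  by apply: sumr_ge0 => j _; rewrite mulr_ge0//; have [] := hW (x, s, j).
rewrite exchange_big/= -[RHS]Q1; apply: eq_bigr => j _.
by rewrite -mulr_sumr; have [_ ->] := hW (x, s, j); rewrite mulr1.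
Qed.

Variable c : gp_input R X S.

Definition aux_state (u : aux c) (s : S) : R := PS s * aux_law c s u.

Definition aux_output (Q : S -> J -> R) (u : aux c) (y : Y) : R :=
  \sum_s aux_state u s * averaged Q (input_map c u s) s y.

Lemma aux_state_ge0 u s : 0 <= aux_state u s.
Proof.
by rewrite mulr_ge0//; [case: hPS|case: (aux_lawP c s)].
Qed.

Lemma sum_aux_state s : \sum_u aux_state u s = PS s.
Proof.
by rewrite -mulr_sumr; case: (aux_lawP c s) => _ ->; rewrite mulr1.
Qed.

Lemma aux_output_ge0 Q u y : is_cond_pmf Q -> 0 <= aux_output Q u y.
Proof.
move=> hQ; apply: sumr_ge0 => s _; rewrite mulr_ge0 ?aux_state_ge0//.
by have [] := averaged_pmf (input_map c u s) s hQ.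
Qed.

Lemma sum_aux_output Q u : is_cond_pmf Q ->
  \sum_y aux_output Q u y = \sum_s aux_state u s.
Proof.
move=> hQ; rewrite exchange_big/=; apply: eq_bigr => s _.
by rewrite -mulr_sumr; have [_ ->] := averaged_pmf (input_map c u s) s hQ;
  rewrite mulr1.
Qed.

Lemma sum_aux : \sum_u \sum_s aux_state u s = 1.
Proof.
by rewrite exchange_big/=; under eq_bigr do rewrite sum_aux_state; case: hPS.
Qed.

Lemma sum_aux_output1 Q : is_cond_pmf Q -> \sum_u \sum_y aux_output Q u y = 1.
Proof.
move=> hQ; rewrite -sum_aux; apply: eq_bigr => u _.
exact: sum_aux_output.
Qed.

Lemma gp_joint_sum Q (F : aux c -> S -> Y -> R) :
  \sum_w gp_joint PS W Q w * F w.1.1.1.1 w.1.1.1.2 w.2 =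
  \sum_u \sum_s \sum_y
    aux_state u s * averaged Q (input_map c u s) s y * F u s y.
Proof.
pose g (w : aux c * S * J * X * Y) :=
  gp_joint PS W Q w * F w.1.1.1.1 w.1.1.1.2 w.2.
transitivity (\sum_u \sum_s \sum_j \sum_x \sum_y g (u, s, j, x, y)).
  by rewrite !pair_bigA; apply: eq_bigr => -[[[[u s] j] x] y] _.
apply: eq_bigr => u _; apply: eq_bigr => s _.
transitivity (\sum_j \sum_y aux_state u s *
    (Q s j * W (input_map c u s, s, j) y) * F u s y).
  apply: eq_bigr => j _; rewrite (bigD1 (input_map c u s))//= [X in _ + X]big1 ?addr0.
    by apply: eq_bigr => y _; rewrite /g/= eqxx /aux_state mulr1n; ring.
  move=> x /negbTE xE; rewrite big1// => y _.
  by rewrite /g/= xE mulr0n; ring.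
rewrite exchange_big/=; apply: eq_bigr => y _.
by rewrite -mulr_suml -mulr_sumr.
Qed.

Lemma gp_joint_ge0 Q w : is_cond_pmf Q -> 0 <= gp_joint PS W (c := c) Q w.
Proof.
case: w => -[[[u s] j] x] y hQ /=.
by rewrite !mulr_ge0//; [case: hPS|case: (aux_lawP c s)|
  case: (hQ s)|case: (hW (x, s, j))].
Qed.

Lemma gp_rateE Q : is_cond_pmf Q ->
  gp_rate PS W c Q = info_gap aux_state (aux_output Q) / ln 2.
Proof.
move=> hQ; rewrite /gp_rate; set p := gp_joint _ _ _.
have p0 w : 0 <= p w by exact: gp_joint_ge0.
have lawUS u s : law p (fun w => (w.1.1.1.1, w.1.1.1.2)) (u, s) = aux_state u s.
  rewrite lawE.
  rewrite (gp_joint_sum Q (fun u' s' _ => ((u', s') == (u, s))%:R)).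
  rewrite (bigD1 u)//= [X in _ + X]big1 ?addr0; last first.
    move=> u' /negbTE uE; rewrite big1// => s' _; rewrite big1// => y _.
    by rewrite xpair_eqE uE mulr0.
  rewrite (bigD1 s)//= [X in _ + X]big1 ?addr0; last first.
    move=> s' /negbTE sE; rewrite big1// => y _.
    by rewrite xpair_eqE sE andbF mulr0.
  under eq_bigr do rewrite eqxx mulr1.
  by rewrite -mulr_sumr; case: (averaged_pmf (input_map c u s) s hQ) => _ ->;
    rewrite mulr1.
have lawUY u y : law p (fun w => (w.1.1.1.1, w.2)) (u, y) = aux_output Q u y.
  rewrite lawE.
  rewrite (gp_joint_sum Q (fun u' _ y' => ((u', y') == (u, y))%:R)).
  rewrite (bigD1 u)//= [X in _ + X]big1 ?addr0; last first.
    move=> u' /negbTE uE; rewrite big1// => s' _; rewrite big1// => y' _.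
    by rewrite xpair_eqE uE mulr0.
  apply: eq_bigr => s _; rewrite (bigD1 y)//= [X in _ + X]big1 ?addr0.
    by rewrite eqxx mulr1.
  move=> y' /negbTE yE.
  by rewrite xpair_eqE yE andbF mulr0.
have lawS s : law p (fun w => w.1.1.1.2) s = PS s.
  rewrite -sum_aux_state; under [RHS]eq_bigr do rewrite -lawUS lawE.
  rewrite exchange_big lawE; apply: eq_bigr => w _ /=.
  rewrite -mulr_sumr; congr (_ * _);
  rewrite (bigD1 w.1.1.1.1)//= [X in _ + X]big1 ?addr0.
    by rewrite xpair_eqE eqxx.
  by move=> u' /negbTE uE; rewrite xpair_eqE [_ == u']eq_sym uE.
have lawY y : law p (fun w => w.2) y = \sum_u aux_output Q u y.
  under [RHS]eq_bigr do rewrite -lawUY lawE.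
  rewrite exchange_big lawE; apply: eq_bigr => w _ /=.
  rewrite -mulr_sumr; congr (_ * _);
  rewrite (bigD1 w.1.1.1.1)//= [X in _ + X]big1 ?addr0.
    by rewrite xpair_eqE eqxx.
  by move=> u' /negbTE uE; rewrite xpair_eqE [_ == u']eq_sym uE.
rewrite !mutual_infoE// -mulrBl -sumrB; congr (_ / _).
transitivity (\sum_w p w * ln (law p (fun w => (w.1.1.1.1, w.2)) (w.1.1.1.1, w.2))
  - \sum_w p w * ln (law p (fun w => w.2) w.2)
  - \sum_w p w *
      ln (law p (fun w => (w.1.1.1.1, w.1.1.1.2)) (w.1.1.1.1, w.1.1.1.2))
  + \sum_w p w * ln (law p (fun w => w.1.1.1.2) w.1.1.1.2)).
  rewrite -!sumrB -big_split/=; apply: eq_bigr => w _.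
  by ring.
have E (A : finType) (f : _ -> A) := sum_law p f (fun a => ln (law p f a)).
rewrite !E /info_gap; congr (_ - _ - _ + _).
- by rewrite pair_bigA; apply: eq_bigr => -[u y] _; rewrite lawUY.
- by apply: eq_bigr => y _; rewrite lawY.
- by rewrite pair_bigA; apply: eq_bigr => -[u s] _; rewrite lawUS.
- by apply: eq_bigr => s _; rewrite lawS sum_aux_state.
Qed.

End GPRate.

(** * Reduction to strategies *)

Lemma law_fibre (R : realType) (T A B : finType) (p : T -> R) (f : T -> A)
    (a : A) (h : B -> T) (h' : T -> B) :
  (forall b, f (h b) = a) -> cancel h h' -> (forall t, f t = a -> h (h' t) = t) ->
  law p f a = \sum_b p (h b).
Proof.
move=> fh hK h'K; rewrite /law (reindex_onto h h').
  by apply: eq_bigl => b; rewrite fh hK !eqxx.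
by move=> t /eqP /h'K.
Qed.

Section Strategies.
Context {R : realType} {U X Y S : finType}.
Variables (PS : S -> R) (x0 : X) (q : U -> S -> X -> R).
Hypotheses (hPS : is_pmf PS) (PS0 : forall s, 0 < PS s).
Hypotheses (q0 : forall u s x, 0 <= q u s x).
Hypothesis qPS : forall s, \sum_u \sum_x q u s x = PS s.

Let qs u s := \sum_x q u s x.

Let qs0 u s : 0 <= qs u s. Proof. exact: sumr_ge0. Qed.

(** The conditional law of the input. The point mass at [x0] on null pairs [(u, s)] makes it a
    probability law everywhere, so that [kappa] is normalized. *)
Definition input_given u s x : R :=
  if qs u s == 0 then (x == x0)%:R else q u s x / qs u s.

Lemma input_given_pmf u s : is_pmf (input_given u s).
Proof.
rewrite /is_pmf /input_given; case: eqP => [_|/eqP qus]; split.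
- by move=> x; rewrite ler0n.
- rewrite (bigD1 x0)//= eqxx [X in _ + X]big1 ?addr0// => x /negbTE ->.
  by [].
- by move=> x; rewrite divr_ge0.
- by rewrite -mulr_suml mulfV.
Qed.

Lemma input_givenE u s x : qs u s * input_given u s x = q u s x.
Proof.
rewrite /input_given; case: eqP => [q00|/eqP qus].
  rewrite q00 mul0r; apply/esym/eqP; move/eqP: q00.
  by rewrite /qs psumr_eq0// => /allP/(_ x); rewrite mem_index_enum; apply.
by rewrite mulrC divfK.
Qed.

Let kappa u (t : {ffun S -> X}) := prodw (input_given u) t.

Let kappa0 u t : 0 <= kappa u t.
Proof. by apply: prodw_ge0 => s x; have [] := input_given_pmf u s. Qed.

Let kappa_marginal u s (G : X -> R) :
  \sum_t kappa u t * G (t s) = \sum_x input_given u s x * G x.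
Proof.
rewrite /kappa (prodw_marginal (p := input_given u) s G)// => k.
by have [] := input_given_pmf u k.
Qed.

Let kappa1 u : \sum_t kappa u t = 1.
Proof. by apply: sum_prodw1 => s; exact: input_given_pmf. Qed.

(* The strategy [t] has conditionally independent values given [U = u], each
   [t s] following the law of the input given [(u, s)]; in particular it is
   conditionally independent of the state given [U]. *)
Definition strategy_law (s : S) (t : {ffun S -> X}) : R :=
  (\sum_u qs u s * kappa u t) / PS s.

Let b t s := PS s * strategy_law s t.

Let bE t s : b t s = \sum_u qs u s * kappa u t.
Proof. by rewrite /b /strategy_law mulrC divfK// gt_eqF. Qed.

Let b0 t s : 0 <= b t s.
Proof. by rewrite bE sumr_ge0// => u _; rewrite mulr_ge0. Qed.

Let sum_b s : \sum_t b t s = PS s.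
Proof.
under eq_bigr do rewrite bE.
rewrite exchange_big -[RHS]qPS; apply: eq_bigr => u _ /=.
by rewrite -mulr_sumr kappa1 mulr1.
Qed.

Lemma strategy_law_pmf : is_cond_pmf strategy_law.
Proof.
move=> s; split=> [t|].
  by rewrite -(pmulr_rge0 _ (PS0 s)); exact: b0.
apply: (@mulfI _ (PS s)); first by rewrite gt_eqF.
by rewrite mulr_sumr mulr1; exact: sum_b.
Qed.

Variable w : X -> S -> Y -> R.
Hypothesis hw : forall x s, is_pmf (w x s).

Let A u y := \sum_s \sum_x q u s x * w x s y.
Let B t y := \sum_s b t s * w (t s) s y.

Let w0 x s y : 0 <= w x s y. Proof. by have [] := hw x s. Qed.
Let w1 x s : \sum_y w x s y = 1. Proof. by have [] := hw x s. Qed.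

Let A0 u y : 0 <= A u y.
Proof. by do 2 (apply: sumr_ge0 => ? _); rewrite mulr_ge0. Qed.

Let B0 t y : 0 <= B t y.
Proof. by apply: sumr_ge0 => ? _; rewrite mulr_ge0. Qed.

(** One space carrying [U], the strategy, the state and the output: the pair marginals of [p] are
    [A], [B], [qs] and [b], so both gaps become expectations under [p]. *)
Let T := (U * {ffun S -> X} * S * Y)%type.
Let p (z : T) := let: (u, t, s, y) := z in
  qs u s * kappa u t * w (t s) s y.

Let p0 z : 0 <= p z.
Proof. by case: z => -[[u t] s] y; rewrite /p !mulr_ge0. Qed.

Let lawUY u y : law p (fun z => (z.1.1.1, z.2)) (u, y) = A u y.
Proof.
rewrite (law_fibre p (h := fun ts => (u, ts.1, ts.2, y))
  (h' := fun z : T => (z.1.1.2, z.1.2))) => //; first last.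
- by case=> -[[u' t] s] y' /= [-> ->].
- by case.
rewrite -(pair_bigA _ (fun t s => p (u, t, s, y)))/= exchange_big/=.
apply: eq_bigr => s _; under eq_bigr do rewrite -mulrA.
rewrite -mulr_sumr (kappa_marginal u s (fun x => w x s y)) mulr_sumr.
by apply: eq_bigr => x _; rewrite mulrA input_givenE.
Qed.

Let lawTY t y : law p (fun z => (z.1.1.2, z.2)) (t, y) = B t y.
Proof.
rewrite (law_fibre p (h := fun us => (us.1, t, us.2, y))
  (h' := fun z : T => (z.1.1.1, z.1.2))) => //; first last.
- by case=> -[[u t'] s] y' /= [-> ->].
- by case.
rewrite -(pair_bigA _ (fun u s => p (u, t, s, y)))/= exchange_big/=.
by apply: eq_bigr => s _; rewrite -mulr_suml -bE.
Qed.

Let lawUS u s : law p (fun z => (z.1.1.1, z.1.2)) (u, s) = qs u s.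
Proof.
rewrite (law_fibre p (h := fun ty => (u, ty.1, s, ty.2))
  (h' := fun z : T => (z.1.1.2, z.2))) => //; first last.
- by case=> -[[u' t] s'] y' /= [-> ->].
- by case.
rewrite -(pair_bigA _ (fun t y => p (u, t, s, y)))/=.
under eq_bigr do rewrite -mulr_sumr w1 mulr1.
by rewrite -mulr_sumr kappa1 mulr1.
Qed.

Let lawTS t s : law p (fun z => (z.1.1.2, z.1.2)) (t, s) = b t s.
Proof.
rewrite (law_fibre p (h := fun uy => (uy.1, t, s, uy.2))
  (h' := fun z : T => (z.1.1.1, z.2))) => //; first last.
- by case=> -[[u' t'] s'] y' /= [-> ->].
- by case.
rewrite -(pair_bigA _ (fun u y => p (u, t, s, y)))/=.
by under eq_bigr do rewrite -mulr_sumr w1 mulr1; rewrite -bE.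
Qed.

Let sumA_B y : \sum_u A u y = \sum_t B t y.
Proof.
under eq_bigr do rewrite -lawUY lawE; under [RHS]eq_bigr do rewrite -lawTY lawE.
rewrite exchange_big [RHS]exchange_big; apply: eq_bigr => z _ /=.
rewrite -!mulr_sumr; congr (_ * _).
rewrite (bigD1 z.1.1.1)//= [X in _ + X]big1 ?addr0; last first.
  by move=> u' /negbTE uE; rewrite xpair_eqE [_ == u']eq_sym uE.
rewrite [RHS](bigD1 z.1.1.2)//= [X in _ = _ + X]big1 ?addr0.
  by rewrite !xpair_eqE !eqxx.
by move=> t' /negbTE tE; rewrite xpair_eqE [_ == t']eq_sym tE.
Qed.

(* With [U] averaged out given [T], the Markov chain [U - (T, S) - Y] and the
   conditional independence of [T] and [S] given [U] make
   [p(u,y) p(t,s) / (p(u,s) p(t,y))] a ratio of total mass at most [1]. *)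
Lemma info_gap_strategy : info_gap qs A <= info_gap b B.
Proof.
pose r (z : T) := A z.1.1.1 z.2 * b z.1.1.2 z.1.2 /
   (qs z.1.1.1 z.1.2 * B z.1.1.2 z.2).
have pos z : 0 < p z -> [/\ 0 < A z.1.1.1 z.2, 0 < b z.1.1.2 z.1.2,
    0 < qs z.1.1.1 z.1.2 & 0 < B z.1.1.2 z.2].
  move=> pz; rewrite -lawUY -lawUS -lawTY -lawTS; split.
  - exact: (law_gt0 p0 (fun z : T => (z.1.1.1, z.2)) pz).
  - exact: (law_gt0 p0 (fun z : T => (z.1.1.2, z.1.2)) pz).
  - exact: (law_gt0 p0 (fun z : T => (z.1.1.1, z.1.2)) pz).
  - exact: (law_gt0 p0 (fun z : T => (z.1.1.2, z.2)) pz).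
have G : \sum_z p z * ln (r z) <= 0.
  apply: gibbs => //.
    by move=> z /pos[? ? ? ?]; apply: divr_gt0; apply: mulr_gt0.
  rewrite -(sum_lawT p (fun z => (z.1.1.1, z.2))).
  rewrite (eq_bigr (fun uy => A uy.1 uy.2)) => [|[u y] _]; last exact: lawUY.
  rewrite -(pair_bigA _ A)/=.
  rewrite (_ : \sum_z _ = \sum_u \sum_t \sum_s \sum_y
     p (u, t, s, y) * r (u, t, s, y)); last first.
    by rewrite !pair_bigA/=; apply: eq_bigr => -[[[u t] s] y] _.
  apply: ler_sum => u _; rewrite [leLHS](_ : _ = \sum_y \sum_t \sum_s
      p (u, t, s, y) * r (u, t, s, y)); last first.
    by rewrite [RHS]exchange_big; apply: eq_bigr => t _; exact: exchange_big.
  apply: ler_sum => y _.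
  rewrite -[leRHS]mul1r -(kappa1 u) mulr_suml; apply: ler_sum => t _.
  (* The quotient [B t y / B t y] stands for [1] where [B] does not vanish; unfolding its numerator
     matches the sum over [s] term by term. *)
  apply: (@le_trans _ _ (kappa u t * A u y * (B t y / B t y))); last first.
    rewrite ler_piMr ?mulr_ge0//; have [->|B1] := eqVneq (B t y) 0.
      by rewrite mul0r.
    by rewrite divff.
  rewrite {1}/B mulr_suml mulr_sumr; apply: ler_sum => s _; rewrite /r/=.
  have [->|qus] := eqVneq (qs u s) 0.
    rewrite !mul0r. by do ![apply: mulr_ge0 => //]; rewrite invr_ge0.
  rewrite [leLHS](_ : _ = qs u s / qs u s *
      (kappa u t * A u y * (b t s * w (t s) s y / B t y))).
    by rewrite divff// mul1r.
  by rewrite invfM; ring.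
have {G} : \sum_u \sum_y xlnx (A u y) + \sum_t \sum_s xlnx (b t s)
    - \sum_u \sum_s xlnx (qs u s) - \sum_t \sum_y xlnx (B t y) <= 0.
  apply: le_trans G; rewrite le_eqVlt; apply/orP; left; apply/eqP.
  transitivity (\sum_z p z * ln (A z.1.1.1 z.2)
      + \sum_z p z * ln (b z.1.1.2 z.1.2)
      - \sum_z p z * ln (qs z.1.1.1 z.1.2) - \sum_z p z * ln (B z.1.1.2 z.2)).
    congr (_ + _ - _ - _); apply/esym.
    - rewrite (sum_law p (fun z => (z.1.1.1, z.2)) (fun a => ln (A a.1 a.2))).
      by rewrite pair_bigA; apply: eq_bigr => -[u y] _; rewrite lawUY.
    - rewrite (sum_law p (fun z => (z.1.1.2, z.1.2)) (fun a => ln (b a.1 a.2))).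
      by rewrite pair_bigA; apply: eq_bigr => -[t s] _; rewrite lawTS.
    - rewrite (sum_law p (fun z => (z.1.1.1, z.1.2)) (fun a => ln (qs a.1 a.2))).
      by rewrite pair_bigA; apply: eq_bigr => -[u s] _; rewrite lawUS.
    - rewrite (sum_law p (fun z => (z.1.1.2, z.2)) (fun a => ln (B a.1 a.2))).
      by rewrite pair_bigA; apply: eq_bigr => -[t y] _; rewrite lawTY.
  rewrite -big_split -!sumrB/=; apply: eq_bigr => z _.
  have := p0 z; rewrite le_eqVlt => /predU1P[<- | /[dup] pz /pos[? ? ? ?]].
    by rewrite !mul0r addr0 !subr0.
  rewrite /r ln_div; [|by rewrite posrE; apply: mulr_gt0..].
  rewrite [ln (A _ _ * _)]lnM ?posrE// [ln (qs _ _ * _)]lnM ?posrE//.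
  by ring.
rewrite /info_gap.
(* The terms still missing are the entropies of [Y] and [S], which agree on both sides. *)
under [X in _ -> _ - X - _ + _ <= _]eq_bigr do rewrite sumA_B.
have -> : \sum_s xlnx (\sum_u qs u s) = \sum_s xlnx (\sum_t b t s).
  by apply: eq_bigr => s _; rewrite sum_b -qPS.
by lra.
Qed.

End Strategies.

(** * Existence of the max-min value *)

(** A minimum of continuous functions is upper semicontinuous, which is enough for a maximum on a
    compact set. The superlevel sets of [m] form a filter base, and a cluster point in [K] is the
    maximizer. *)
Lemma maxmin_exists (R : realType) (A : topologicalType) (B : Type)
    (K : set A) (D : set B) (f : A -> B -> R) (m : A -> R) :
  compact K -> K !=set0 -> (forall a, K a -> is_minimum (f a @` D) (m a)) ->
  (forall b, D b -> continuous (f ^~ b)) ->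
  exists2 a, K a & forall a', K a' -> m a' <= m a.
Proof.
move=> cK K0 fm fc.
pose E a' := [set a | K a /\ m a' <= m a].
pose F := filter_from K E.
have FF : ProperFilter F.
  apply: filter_from_proper; last by move=> a Ka; exists a.
  apply: filter_from_filter => // a a' Ka Ka'.
  have [aa'|a'a] := leP (m a) (m a').
    exists a' => // c [Kc a'c]; split; split => //.
    exact: le_trans a'c.
  exists a => // c [Kc ac]; split; split => //.
  exact: le_trans (ltW a'a) _.
have [|a [Ka aF]] := cK F FF.
  by have [a Ka] := K0; exists a => // c [].
exists a => // a' Ka'; have [[b Db <-] _] := fm a Ka.
(* With [b] attaining [m a], the goal is [m a' <= f a b]: a closed condition on the first argument
   that holds on the superlevel set of [a']. *)
have cl : closed [set c | m a' <= f c b].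
  apply: (@preimage_closed _ _ (f ^~ b) [set z | m a' <= z]).
    by move=> c _; exact: fc.
  exact: closed_ge.
apply: cl; rewrite clusterE in aF; apply: (aF [set c | m a' <= f c b]).
exists a' => // c [Kc]; have [_ +] := fm c Kc => lbc /le_trans; apply.
by apply: lbc; exists b.
Qed.

(** * Continuity of entropies and compactness of the set of kernels *)

Section Continuity.
Context {R : realType}.

Lemma continuous_sum (A : topologicalType) (I : finType) (F : I -> A -> R) :
  (forall i, continuous (F i)) -> continuous (fun a => \sum_i F i a).
Proof.
move=> cF a; elim: (index_enum I) => [|i s IH].
  under eq_fun do rewrite big_nil; exact: cst_continuous.
under eq_fun do rewrite big_cons.
by apply: (@continuousD R R A (F i) (fun a => \sum_(j <- s) F j a)) => //; exact: cF.
Qed.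

(** Serves the continuity at [0]. Below [1], [- ln x = 2 ln (1 / sqrt x) <= 2 / sqrt x] yields the
    first term; above [1], [ln x <= x] yields the second. *)
Lemma xlnx_le (x : R) : `|xlnx x| <= 2 * Num.sqrt `|x| + `|x| * `|x|.
Proof.
rewrite /xlnx; have [x0|x0] := leP x 0.
  by rewrite ln0// mulr0 normr0 addr_ge0 ?mulr_ge0 ?sqrtr_ge0.
rewrite normrM (gtr0_norm x0).
have s0 : 0 < Num.sqrt x by rewrite sqrtr_gt0.
have [x1|x1] := leP 1 x.
  rewrite ger0_norm ?ln_ge0//.
  rewrite ler_wpDl ?mulr_ge0 ?sqrtr_ge0// ler_pM2l//.
  by rewrite ltW// ln_sublinear.
rewrite ler0_norm ?ln_le0//; last exact: ltW.
apply: (@le_trans _ _ (2 * Num.sqrt x)); last by rewrite lerDl mulr_ge0 ?(ltW x0).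
have -> : - ln x = 2 * ln (Num.sqrt x)^-1.
  by rewrite -{1}(sqr_sqrtr (ltW x0)) lnXn// lnV ?posrE// mulr2n; ring.
rewrite -{1}(sqr_sqrtr (ltW x0)) expr2 mulrCA ler_pM2l// -mulrA.
rewrite -[leRHS]mulr1 ler_pM2l// -ler_pdivlMl// mulr1.
by rewrite ltW// ln_sublinear// invr_gt0.
Qed.

Lemma continuous_xlnx : continuous (@xlnx R).
Proof.
move=> x; have [x0|x0|->] := ltgtP x 0.
- apply: (@cvg_near_cst _ _ _ _ _ _); rewrite /xlnx ln0 ?mulr0 ?ltW//.
  near=> y; rewrite ln0 ?mulr0// ltW//; near: y.
  exact: lt_nbhsl.
- by apply: cvgM => //; exact: continuous_ln.
- rewrite /continuous_at {2}/xlnx mul0r.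
  apply/norm_cvg0P.
  apply: (@squeeze_cvgr _ _ _ _ (fun=> 0)
    (fun y : R => 2 * Num.sqrt `|y| + `|y| * `|y|)).
  + by apply: nearW => y; rewrite normr_ge0 xlnx_le.
  + exact: cvg_cst.
  + have c : continuous (fun y : R => 2 * Num.sqrt `|y| + `|y| * `|y|).
      move=> y; apply: (@continuousD R R R (fun y => 2 * Num.sqrt `|y|)
        (fun y => `|y| * `|y|)).
        apply: (@continuousM R R (cst 2) (fun y => Num.sqrt `|y|)).
          exact: cst_continuous.
        by apply: (@continuous_comp R R R (@Num.norm R R) (@Num.sqrt R));
          [exact: norm_continuous|exact: sqrt_continuous].
      by apply: (@continuousM R R (@Num.norm R R) (@Num.norm R R));
        exact: norm_continuous.
    by move: (c 0); rewrite /continuous_at normr0 sqrtr0 !mulr0 addr0; apply.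
Unshelve. all: by end_near. Qed.

Lemma continuous_info_gap (A : topologicalType) (U S Y : finType)
    (a : A -> U -> S -> R) (b : A -> U -> Y -> R) :
  (forall u s, continuous (fun t => a t u s)) ->
  (forall u y, continuous (fun t => b t u y)) ->
  continuous (fun t => info_gap (a t) (b t)).
Proof.
move=> ca cb t.
have cx (g : A -> R) : continuous g -> continuous (fun t => xlnx (g t)).
  by move=> cg r; apply: continuous_comp; [exact: cg|exact: continuous_xlnx].
rewrite /info_gap.
apply: cvgD; [apply: cvgB; [apply: cvgB|]|].
- move: t; apply: continuous_sum => u; apply: continuous_sum => y.
  exact/cx/cb.
- move: t; apply: continuous_sum => y; apply/cx; apply: continuous_sum => u.
  exact/cb.
- move: t; apply: continuous_sum => u; apply: continuous_sum => s.
  exact/cx/ca.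
- move: t; apply: continuous_sum => s; apply/cx; apply: continuous_sum => u.
  exact/ca.
Qed.

Lemma continuous_linear_form (A : finType) (I : finType) (h : I -> A) (k : I -> R) :
  continuous (fun f : prod_topology (fun _ : A => R) => \sum_i f (h i) * k i).
Proof.
apply: (@continuous_sum (prod_topology (fun _ : A => R)) I
  (fun i f => f (h i) * k i)) => i f.
apply: (@continuousM R (prod_topology (fun _ : A => R)) (proj (h i))
  (cst (k i))); first exact: proj_continuous.
exact: cst_continuous.
Qed.

(** Uncurried, so that the product topology and Tychonoff's theorem apply. *)
Definition kernels (A B : finType) : set (prod_topology (fun _ : A * B => R)) :=
  [set f | is_cond_pmf (fun a b => f (a, b))].

Lemma compact_kernels (A B : finType) : compact (@kernels A B).
Proof.
apply: (@subclosed_compact _ _ [set f : prod_topology (fun _ : A * B => R) |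
    forall i, `[0, 1]%classic (f i)]).
- have -> : @kernels A B =
      (\bigcap_(i in [set: A * B]) [set f | 0 <= f i]) `&`
      (\bigcap_(a in [set: A]) [set f | \sum_b f (a, b) = 1]).
    apply/seteqP; split=> f /=.
      by move=> fK; split=> [[a b] _|a _] /=; have [] := fK a.
    by move=> [f0 f1] a; split=> [b|]; [exact: (f0 (a, b))|exact: f1].
  apply: closedI.
    apply: closed_bigI => i _.
    apply: (@preimage_closed (prod_topology (fun _ : A * B => R)) R
      (proj i) [set z | 0 <= z]).
      by move=> f _; exact: proj_continuous.
    exact: closed_ge.
  apply: closed_bigI => a _.
  apply: (@preimage_closed (prod_topology (fun _ : A * B => R)) R
    (fun f : prod_topology (fun _ : A * B => R) =>
     \sum_b f (a, b)) [set z | z = 1]); last exact: closed_eq.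
  move=> f _; move: f; apply: (@continuous_sum
    (prod_topology (fun _ : A * B => R)) B (fun b f => f (a, b))).
  by move=> b; exact: (@proj_continuous _ (fun _ : A * B => R) (a, b)).
- apply: (@tychonoff (A * B)%type (fun=> R) (fun=> `[0, 1]%classic)) => i.
  exact: segment_compact.
- move=> f fK [a b] /=; have [f0 f1] := fK a; rewrite in_itv/= f0/= -f1.
  by rewrite (bigD1 b)//= lerDl sumr_ge0.
Qed.

Lemma dirac_pmf (B : finType) (b0 : B) : is_pmf (fun b => (b == b0)%:R : R).
Proof.
split=> [b|]; first by rewrite ler0n.
by rewrite (bigD1 b0)//= eqxx big1 ?addr0// => b /negbTE ->.
Qed.

Lemma kernels_nonempty (A B : finType) : (0 < #|B|)%N -> @kernels A B !=set0.
Proof.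
move=> /card_gt0P[b0 _]; exists (fun ab => (ab.2 == b0)%:R) => a.
exact: dirac_pmf.
Qed.

End Continuity.

(** * Attainment of the max-min by strategies *)

Section MaxMin.
Context {R : realType} {X Y S J : finType}.
Variables (PS : S -> R) (W : X * S * J -> Y -> R).
Hypotheses (hX : (0 < #|X|)%N) (hJ : (0 < #|J|)%N).
Hypotheses (hPS : is_pmf PS) (PS0 : forall s, 0 < PS s) (hW : is_cond_pmf W).

Let D := [set Q : S -> J -> R | is_cond_pmf Q].

Lemma ln2_gt0 : 0 < ln 2 :> R.
Proof. by rewrite ln_gt0// ltr1n. Qed.

Lemma gp_rate_min (c : gp_input R X S) :
  exists m, is_minimum (gp_rate PS W c @` D) m.
Proof.
pose A := prod_topology (fun _ : S * J => R).
pose f (Q : A) := info_gap (aux_state PS (c := c))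
  (aux_output PS W (c := c) (fun s j => Q (s, j))).
have cf : continuous f.
  apply: (@continuous_info_gap R A _ _ _ (fun _ => aux_state PS (c := c))
    (fun Q : A => aux_output PS W (c := c) (fun s j => Q (s, j)))).
    by move=> u s; exact: cst_continuous.
  move=> u y; apply: (@continuous_sum R A S (fun s (Q : A) =>
    aux_state PS u s * averaged W (fun s j => Q (s, j)) (input_map c u s) s y)).
  move=> s; rewrite /averaged => Q.
  apply: (@continuousM R A (cst _)
    (fun Q : A => \sum_j Q (s, j) * W (input_map c u s, s, j) y)).
    exact: cst_continuous.
  exact: (@continuous_linear_form R (S * J)%type J (fun j => (s, j))
    (fun j => W (input_map c u s, s, j) y)).
have [//|||Q /set_mem KQ fQ] := @compact_EVT_min A R f (@kernels R S J).
- exact: kernels_nonempty.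
- exact: compact_kernels.
- exact: continuous_subspaceT.
exists (gp_rate PS W c (fun s j => Q (s, j))); split.
  by exists (fun s j => Q (s, j)).
move=> _ [Q' hQ' <-]; rewrite !gp_rateE// ler_pM2r ?invr_gt0 ?ln2_gt0//.
by apply: (fQ (fun sj => Q' sj.1 sj.2)); rewrite inE.
Qed.

Definition strategy_input (P : S -> {ffun S -> X} -> R) (hP : is_cond_pmf P) :
    gp_input R X S :=
  GPInput (eq_leq (card_ffun S X)) hP (fun t s => t s).

(** The second half is the form that the converse consumes: [U] is of any size and the input may be
    random given [(u, s)]. *)
Lemma strategy_maxmin : exists (c : gp_input R X S) (C : R),
  is_minimum (gp_rate PS W c @` D) C /\
  forall (U : finType) (q : U -> S -> X -> R),
    (forall u s x, 0 <= q u s x) -> (forall s, \sum_u \sum_x q u s x = PS s) ->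
    exists2 Q, D Q & info_gap (fun u s => \sum_x q u s x)
      (fun u y => \sum_s \sum_x q u s x * averaged W Q x s y) <= C * ln 2.
Proof.
pose T : finType := {ffun S -> X}.
pose A := prod_topology (fun _ : S * T => R).
pose f (P : A) (Q : S -> J -> R) := info_gap (fun t s => PS s * P (s, t))
  (fun (t : T) y => \sum_s PS s * P (s, t) * averaged W Q (t s) s y).
have fE (P : A) (KP : is_cond_pmf (fun s t => P (s, t))) Q :
    D Q -> f P Q = gp_rate PS W (strategy_input KP) Q * ln 2.
  by move=> DQ; rewrite gp_rateE// divfK// gt_eqF// ln2_gt0.
(* The default [0] can be taken only off [kernels], where no minimum is claimed. *)
pose m (P : A) := xget 0 [set v | is_minimum (f P @` D) v].
have mP (P : A) : kernels P -> is_minimum (f P @` D) (m P).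
  move=> KP; rewrite /m; case: xgetP => [y -> //|noP].
  have [v [[Q DQ Qv] vl]] := gp_rate_min (strategy_input KP).
  exfalso; apply: (noP (v * ln 2)); split.
    by exists Q => //; rewrite (fE P KP)// Qv.
  move=> _ [Q' DQ' <-]; rewrite (fE P KP)// ler_pM2r ?ln2_gt0//.
  by apply: vl; exists Q'.
have [||P KP Pmax] := maxmin_exists (f := f) (@compact_kernels R S T) _ mP.
- apply: kernels_nonempty; have [x _] := card_gt0P hX.
  by apply/card_gt0P; exists [ffun=> x].
- move=> Q DQ; apply: (@continuous_info_gap R A _ _ _
    (fun (P : A) t s => PS s * P (s, t))
    (fun (P : A) (t : T) y =>
      \sum_s PS s * P (s, t) * averaged W Q (t s) s y)).
    move=> t s P; apply: (@continuousM R A (cst (PS s)) (proj (s, t))).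
      exact: cst_continuous.
    exact: (@proj_continuous _ (fun _ : S * T => R)).
  move=> t y; apply: (@continuous_sum R A S
    (fun s (P : A) => PS s * P (s, t) * averaged W Q (t s) s y)) => s P.
  apply: (@continuousM R A (fun P : A => PS s * P (s, t)) (cst _)); last first.
    exact: cst_continuous.
  apply: (@continuousM R A (cst (PS s)) (proj (s, t))).
    exact: cst_continuous.
  exact: (@proj_continuous _ (fun _ : S * T => R)).
have ln20 := ln2_gt0.
exists (strategy_input KP), (m P / ln 2); split.
  have [[Q DQ fQ] fl] := mP P KP; split.
    by exists Q => //; rewrite -fQ (fE P KP)// mulfK// gt_eqF.
  move=> _ [Q' DQ' <-]; rewrite ler_pdivrMr// -fE//.
  by apply: fl; exists Q'.
move=> U q q0 qPS; have [x0 _] := card_gt0P hX.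
pose P' : A := fun st => strategy_law PS x0 q st.1 st.2.
have KP' : kernels P' by exact: strategy_law_pmf.
(* The jammer's reply to [q] is the kernel that is optimal against the strategy law of [q]; under
   that same kernel [q] does no better than its strategy law, whose value [m P'] is at most the
   maximum. *)
have [[Q DQ fQ] _] := mP P' KP'.
exists Q => //; rewrite divfK ?gt_eqF//; apply: le_trans (Pmax P' KP').
rewrite -fQ; apply: (@info_gap_strategy R U X Y S PS x0 q) => // x s.
exact: averaged_pmf.
Qed.

Lemma gp_maxmin : exists C : R, is_maxmin D (gp_rate PS W) C /\
  forall (U : finType) (q : U -> S -> X -> R),
    (forall u s x, 0 <= q u s x) -> (forall s, \sum_u \sum_x q u s x = PS s) ->
    exists2 Q, D Q & info_gap (fun u s => \sum_x q u s x)
      (fun u y => \sum_s \sum_x q u s x * averaged W Q x s y) <= C * ln 2.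
Proof.
have [c [C [cC CU]]] := strategy_maxmin; exists C; split => //.
split; first exact: gp_rate_min.
split; first by exists c.
move=> v [c' [_ vl]].
(* A deterministic input map is the special case of a point mass. *)
pose q u s x := aux_state PS u s * (x == input_map c' u s)%:R.
have qE u s (F : X -> R) :
    \sum_x q u s x * F x = aux_state PS u s * F (input_map c' u s).
  rewrite (bigD1 (input_map c' u s))//= [X in _ + X]big1 ?addr0.
    by rewrite /q eqxx mulr1.
  by move=> x /negbTE xE; rewrite /q xE mulr0 mul0r.
have qE1 u s : \sum_x q u s x = aux_state PS u s.
  by have := qE u s (fun=> 1); under eq_bigr do rewrite mulr1; rewrite mulr1.
have [||Q DQ QC] := CU _ q.
- by move=> u s x; rewrite mulr_ge0 ?aux_state_ge0.
- by move=> s; under eq_bigr do rewrite qE1; exact: sum_aux_state.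
apply: (@le_trans _ _ (gp_rate PS W c' Q)); first by apply: vl; exists Q.
rewrite gp_rateE// ler_pdivrMr ?ln2_gt0//; apply: le_trans QC.
rewrite /aux_output le_eqVlt; apply/orP; left; apply/eqP; congr info_gap.
  by apply/funext => u; apply/funext => s; rewrite qE1.
apply/funext => u; apply/funext => y; apply: eq_bigr => s _.
by rewrite qE.
Qed.

End MaxMin.

(** * The decoding metric *)

Section MutualInformation.
Context {R : realType} {U Y : finType}.
Implicit Types P : U -> Y -> R.

(** The exponential of the information density. It is kept without the logarithm because the decoder
    multiplies it over letters. *)
Definition density P u y : R := P u y / ((\sum_y' P u y') * \sum_u' P u' y).

Definition mutual_info_nats P : R := \sum_u \sum_y P u y * ln (density P u y).

Section Density.
Variable P : U -> Y -> R.
Hypothesis P0 : forall u y, 0 <= P u y.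

Let row u : 0 <= \sum_y P u y. Proof. exact: sumr_ge0. Qed.
Let col y : 0 <= \sum_u P u y. Proof. exact: sumr_ge0. Qed.

Lemma density_ge0 u y : 0 <= density P u y.
Proof. by rewrite /density divr_ge0 ?mulr_ge0. Qed.

Lemma row_gt0 u y : 0 < P u y -> 0 < \sum_y P u y.
Proof. by move=> Puy; rewrite (bigD1 y)//= ltr_wpDr ?sumr_ge0. Qed.

Lemma col_gt0 u y : 0 < P u y -> 0 < \sum_u P u y.
Proof. by move=> Puy; rewrite (bigD1 u)//= ltr_wpDr ?sumr_ge0. Qed.

Lemma density_gt0 u y : 0 < P u y -> 0 < density P u y.
Proof.
move=> Puy; rewrite /density divr_gt0 ?mulr_gt0 ?(row_gt0 Puy)//.
exact: col_gt0 Puy.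
Qed.

Lemma ln_density u y : 0 < P u y ->
  ln (density P u y) = ln (P u y) - ln (\sum_y P u y) - ln (\sum_u P u y).
Proof.
move=> Puy; have r := row_gt0 Puy; have c := col_gt0 Puy.
by rewrite /density ln_div ?posrE ?mulr_gt0// lnM ?posrE//; ring.
Qed.

(** From [P(u,y) <= P(y)]. The bound depends on the marginal of [U] only, hence not on the
    jammer. *)
Lemma density_le u y : density P u y <= (\sum_y P u y)^-1.
Proof.
rewrite /density invfM mulrCA ler_piMr ?invr_ge0//.
have [->|c0] := eqVneq (\sum_u P u y) 0; first by rewrite invr0 mulr0.
rewrite ler_pdivrMr ?lt_def ?c0 ?col// mul1r.
by rewrite (bigD1 u)//= lerDl sumr_ge0.
Qed.

(** This is what Markov's inequality uses for a wrong codeword, drawn independently of [y]. Equality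
    fails exactly when [y] has mass zero. *)
Lemma density_mass y : \sum_u (\sum_y' P u y') * density P u y <= 1.
Proof.
apply: (@le_trans _ _ (\sum_u P u y / \sum_u P u y)).
  apply: ler_sum => u _; rewrite /density.
  have [r0|r0] := eqVneq (\sum_y' P u y') 0.
    by rewrite r0 mul0r divr_ge0.
  by rewrite invfM mulrCA mulVKf.
rewrite -mulr_suml; have [->|c0] := eqVneq (\sum_u P u y) 0.
  by rewrite mul0r.
by rewrite divff.
Qed.

Lemma mutual_info_natsE : mutual_info_nats P =
  \sum_u \sum_y xlnx (P u y) - \sum_u xlnx (\sum_y P u y)
  - \sum_y xlnx (\sum_u P u y).
Proof.
transitivity (\sum_u \sum_y (xlnx (P u y) - P u y * ln (\sum_y P u y)
    - P u y * ln (\sum_u P u y))).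
  apply: eq_bigr => u _; apply: eq_bigr => y _.
  have := P0 u y; rewrite le_eqVlt => /predU1P[<- | Puy].
    by rewrite /xlnx !mul0r !subr0.
  by rewrite ln_density// /xlnx; ring.
under eq_bigr do rewrite !sumrB.
rewrite !sumrB; congr (_ - _ - _).
  by apply: eq_bigr => u _; rewrite -mulr_suml.
by rewrite exchange_big; apply: eq_bigr => y _; rewrite -mulr_suml.
Qed.

End Density.

(* First-order optimality without calculus: along the segment from [P] to
   [P'] the mutual information is at most its linearization in the density
   of [P] plus a chi-squared remainder of order two. *)
Lemma density_optimal P P' :
  (forall u y, 0 <= P u y) -> (forall u y, 0 <= P' u y) ->
  (forall u, \sum_y P' u y = \sum_y P u y) ->
  \sum_u \sum_y P u y = 1 ->
  (forall u y, 0 < P' u y -> 0 < P u y) ->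
  (forall e, 0 < e <= 1 -> mutual_info_nats P <=
     mutual_info_nats (fun u y => (1 - e) * P u y + e * P' u y)) ->
  mutual_info_nats P <= \sum_u \sum_y P' u y * ln (density P u y).
Proof.
move=> P0 P'0 PP' P1 supp opt.
set I := mutual_info_nats P; set G := (leRHS).
pose chi := \sum_u \sum_y (P' u y - P u y) ^+ 2 / P u y.
have chi0 : 0 <= chi.
  by do 2 (apply: sumr_ge0 => ? _); rewrite divr_ge0 ?sqr_ge0.
have key e : 0 < e <= 1 -> I <= G + e * chi.
  move=> e01; have /andP[e0 e1] := e01.
  pose M u y := (1 - e) * P u y + e * P' u y.
  have M0 u y : 0 <= M u y by rewrite addr_ge0 ?mulr_ge0 ?subr_ge0// ltW.
  have Mrow u : \sum_y M u y = \sum_y P u y.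
    by rewrite big_split/= -!mulr_sumr PP'; ring.
  have Msupp u y : 0 < M u y -> 0 < P u y.
    move=> Muy; rewrite lt_def P0 andbT; apply/eqP => Puy.
    move: Muy; rewrite /M Puy mulr0 add0r pmulr_rgt0// => /supp.
    by rewrite Puy ltxx.
  (* Minus the divergence between the output marginals of [M] and [P]. *)
  have gap : \sum_u \sum_y M u y * ln ((\sum_u P u y) / \sum_u M u y) <= 0.
    pose p z := M z.1 z.2; pose r (z : U * Y) := (\sum_u P u z.2) / \sum_u M u z.2.
    have : \sum_z p z * ln (r z) <= 0.
      apply: gibbs => [z|z pz|]; first exact: M0.
        by apply: divr_gt0; [exact: (col_gt0 P0 (Msupp _ _ pz))|
          exact: (col_gt0 M0 pz)].
      rewrite -(pair_bigA _ (fun u y => p (u, y) * r (u, y)))/=.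
      rewrite -(pair_bigA _ (fun u y => p (u, y)))/=.
      rewrite [leRHS](_ : _ = \sum_u \sum_y P u y); last first.
        by apply: eq_bigr => u _; rewrite -Mrow.
      rewrite exchange_big [leRHS]exchange_big; apply: ler_sum => y _/=.
      rewrite /r/= -mulr_suml mulrCA ler_piMr ?sumr_ge0//.
      have [->|c0] := eqVneq (\sum_u M u y) 0; first by rewrite mul0r.
      by rewrite /p/= divff.
    by rewrite -(pair_bigA _ (fun u y => p (u, y) * ln (r (u, y)))).
  have split : mutual_info_nats M = (1 - e) * I + e * G
      + \sum_u \sum_y M u y * ln (M u y / P u y)
      + \sum_u \sum_y M u y * ln ((\sum_u P u y) / \sum_u M u y).
    rewrite /I /G /mutual_info_nats !mulr_sumr -!big_split; apply: eq_bigr => u _.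
    rewrite !mulr_sumr -!big_split; apply: eq_bigr => y _ /=.
    rewrite !mulrA -mulrDl -/(M u y).
    have := M0 u y; rewrite le_eqVlt => /predU1P[<- | Muy].
      by rewrite !mul0r !addr0.
    have Puy := Msupp _ _ Muy.
    rewrite !ln_density// Mrow !ln_div ?posrE//; last 2 first.
    - exact: (col_gt0 P0 Puy).
    - exact: (col_gt0 M0 Muy).
    by ring.
  (* [ln x <= x - 1] turns the divergence of [M] from [P] into a chi-squared term; the part linear
     in [e] vanishes because [P] and [P'] have the same marginal on [U]. *)
  have quad : \sum_u \sum_y M u y * ln (M u y / P u y) <= e ^+ 2 * chi.
    apply: (@le_trans _ _ (\sum_u \sum_y (e * (P' u y - P u y) +
        e ^+ 2 * ((P' u y - P u y) ^+ 2 / P u y)))).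
      apply: ler_sum => u _; apply: ler_sum => y _.
      have := P0 u y; rewrite le_eqVlt => /predU1P[Puy | Puy].
        have Muy : M u y = 0.
          apply/eqP; rewrite eq_le M0 andbT leNgt; apply/negP => /Msupp.
          by rewrite -Puy ltxx.
        have P'uy : P' u y = 0.
          apply/eqP; rewrite eq_le P'0 andbT leNgt; apply/negP => /supp.
          by rewrite -Puy ltxx.
        by rewrite Muy P'uy -Puy mul0r subrr expr0n/= mul0r !mulr0 addr0.
      have := M0 u y; rewrite le_eqVlt => /predU1P[Muy | Muy].
        rewrite -Muy mul0r.
        have -> : P' u y - P u y = - (P u y / e).
          apply: (@mulfI _ e); first by rewrite gt_eqF.
          rewrite mulrN mulrCA divff ?gt_eqF// mulr1.
          by move: Muy; rewrite /M => /esym/eqP; rewrite -subr_eq0 => /eqP; lra.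
        rewrite le_eqVlt; apply/orP; left; apply/eqP; field.
        by rewrite !gt_eqF.
      apply: (@le_trans _ _ (M u y * (M u y / P u y - 1))).
        rewrite ler_pM2l// -[X in ln X](subrK 1) addrC le_ln1Dx//.
        by rewrite ltrBrDl addrN divr_gt0.
      rewrite le_eqVlt; apply/orP; left; apply/eqP; rewrite /M; field.
      by rewrite gt_eqF.
    under eq_bigr do rewrite big_split/= -!mulr_sumr sumrB PP' subrr mulr0 add0r.
    by rewrite -mulr_sumr.
  have := opt e e01; rewrite -/M -/I split => IM.
  have : e * I <= e * (G + e * chi).
    by rewrite mulrDr mulrA -expr2; lra.
  by rewrite ler_pM2l.
rewrite leNgt; apply/negP => GI.
pose g := I - G; have g0 : 0 < g by rewrite subr_gt0.
have d0 : 0 < g + chi + 1 by rewrite addr_gt0 ?ltr01// ltr_wpDr.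
(* A step [e] below [1] with [e * chi < I - G]. *)
have := key (g / (g + chi + 1)).
rewrite divr_gt0// ler_pdivrMr// mul1r -addrA lerDl addr_ge0// => /(_ isT).
rewrite leNgt => /negP; apply.
rewrite addrA -ltrBrDl -/g mulrAC ltr_pdivrMr// ltr_pM2l//.
by lra.
Qed.

End MutualInformation.

Lemma info_gapE (R : realType) (U S Y : finType)
    (a : U -> S -> R) (b : U -> Y -> R) :
  (forall u s, 0 <= a u s) -> (forall u y, 0 <= b u y) ->
  (forall u, \sum_y b u y = \sum_s a u s) ->
  info_gap a b = mutual_info_nats b - mutual_info_nats a.
Proof.
move=> a0 b0 ab; rewrite !mutual_info_natsE// /info_gap.
under [X in _ = _ - X - _ - _]eq_bigr do rewrite ab.
by ring.
Qed.

Section DecodingMetric.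
Context {R : realType} {X Y S J : finType}.
Variables (PS : S -> R) (W : X * S * J -> Y -> R).
Hypotheses (hJ : (0 < #|J|)%N) (hPS : is_pmf PS) (hW : is_cond_pmf W).
Variable c : gp_input R X S.

Local Notation a := (aux_state PS (c := c)).
Local Notation xmap := (input_map c).

(** The mixing is built into the channel instead of constraining the jammer, so that [gp_rate_min]
    applies to it unchanged. *)
Definition mixed_channel (t : R) (z : X * S * J) (y : Y) : R :=
  (1 - t) * W z y + t / #|J|%:R * \sum_j W (z.1, j) y.

Let J0 : 0 < #|J|%:R :> R. Proof. by rewrite ltr0n. Qed.

Lemma uniform_pmf : is_pmf (fun _ : J => #|J|%:R^-1 : R).
Proof.
split=> [_|]; first by rewrite invr_ge0 ltW.
by rewrite sumr_const -[X in X = _]mulr_natl mulfV// gt_eqF.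
Qed.

Lemma mix_pmf (T : finType) (p q : T -> R) (e : R) : 0 <= e <= 1 ->
  is_pmf p -> is_pmf q -> is_pmf (fun t => (1 - e) * p t + e * q t).
Proof.
move=> /andP[e0 e1] [p0 p1] [q0 q1]; split=> [t|].
  by rewrite addr_ge0// mulr_ge0// subr_ge0.
by rewrite big_split/= -!mulr_sumr p1 q1; ring.
Qed.

Lemma mixed_channel_pmf t : 0 <= t <= 1 -> is_cond_pmf (mixed_channel t).
Proof.
move=> t01 z.
have [u0 u1] : is_pmf (fun y => #|J|%:R^-1 * \sum_j W (z.1, j) y).
  split=> [y|].
    rewrite mulr_ge0 ?invr_ge0 ?(ltW J0)// sumr_ge0// => j _.
    by have [] := hW (z.1, j).
  rewrite -mulr_sumr exchange_big/=.
  rewrite (eq_bigr (fun=> 1)) => [|j _]; last by have [] := hW (z.1, j).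
  by rewrite sumr_const mulVf// gt_eqF.
have [m0 m1] := mix_pmf t01 (hW z) (conj u0 u1); split=> [y|].
  by rewrite /mixed_channel -mulrA; exact: m0.
by rewrite -[RHS]m1; apply: eq_bigr => y _; rewrite /mixed_channel mulrA.
Qed.

Lemma averaged_mixed t Q x s y : is_cond_pmf Q ->
  averaged (mixed_channel t) Q x s y =
  (1 - t) * averaged W Q x s y + t * averaged W (fun _ _ => #|J|%:R^-1) x s y.
Proof.
move=> hQ; rewrite /averaged /mixed_channel -[X in _ = _ + t * X]mulr_sumr.
have [_ Q1] := hQ s.
transitivity (\sum_j ((1 - t) * (Q s j * W (x, s, j) y)
    + Q s j * (t / #|J|%:R * \sum_j W (x, s, j) y))).
  by apply: eq_bigr => j _ /=; ring.
by rewrite big_split/= -mulr_sumr -mulr_suml Q1 mul1r mulrA.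
Qed.

Lemma aux_output_mixed t Q u y : is_cond_pmf Q ->
  aux_output PS (mixed_channel t) (c := c) Q u y =
  (1 - t) * aux_output PS W Q u y
  + t * aux_output PS W (fun _ _ => #|J|%:R^-1) u y.
Proof.
move=> hQ; rewrite /aux_output !mulr_sumr -big_split; apply: eq_bigr => s _/=.
by rewrite averaged_mixed//; ring.
Qed.

Let a0 u s : 0 <= a u s. Proof. exact: aux_state_ge0. Qed.

Definition aux_prior u : R := \sum_s a u s.

Lemma sum_aux_prior : \sum_u aux_prior u = 1.
Proof. exact: (sum_aux hPS). Qed.

(** The metric is the density of the mixed channel under its minimizing kernel. The four properties
    serve, in order: thresholding, finite logarithms on everything any jammer can produce, Markov's
    inequality for wrong codewords, and Chebyshev's inequality for the right one. *)
Lemma decoding_metric (I0 d : R) : 0 < d ->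
  (forall Q, is_cond_pmf Q ->
    I0 <= mutual_info_nats (aux_output PS W (c := c) Q)) ->
  exists iota : aux c -> Y -> R,
  [/\ forall u y, 0 <= iota u y,
      forall u s j y, 0 < a u s * W (xmap u s, s, j) y -> 0 < iota u y,
      forall y, \sum_u aux_prior u * iota u y <= 1 &
      forall Q, is_cond_pmf Q ->
        I0 - d <= \sum_u \sum_y aux_output PS W Q u y * ln (iota u y)].
Proof.
move=> d0 hI0.
pose unif (_ : S) (_ : J) : R := #|J|%:R^-1.
have hunif : is_cond_pmf unif by move=> s; exact: uniform_pmf.
(* [h] is the entropy of [U], which bounds the mean log-metric under uniform jamming. [den] is such
   that [t * (h - I0 + d) <= d], the whole loss in returning from the mixed channel to [W]. *)
pose h := \sum_u - xlnx (aux_prior u).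
pose den := 1 + `|h| + `|I0| + d.
have dden : d < den.
  by rewrite /den; have := normr_ge0 h; have := normr_ge0 I0; lra.
have den0 : 0 < den by exact: lt_trans dden.
pose t := d / den.
have t0 : 0 < t by rewrite divr_gt0.
have t1 : t < 1 by rewrite ltr_pdivrMr// mul1r.
have t01 : 0 <= t <= 1 by rewrite !ltW.
pose W' := mixed_channel t.
have hW' : is_cond_pmf W' by exact: mixed_channel_pmf.
have [_ [[Qs hQs <-] Qmin]] := gp_rate_min hJ hPS hW' c.
pose V Q := aux_output PS W' (c := c) Q.
have VE Q : is_cond_pmf Q -> forall u y, V Q u y =
    (1 - t) * aux_output PS W Q u y + t * aux_output PS W unif u y.
  by move=> hQ u y; exact: aux_output_mixed.
have V0 Q u y : is_cond_pmf Q -> 0 <= V Q u y.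
  by move=> hQ; exact: aux_output_ge0.
have Vrow Q u : is_cond_pmf Q -> \sum_y V Q u y = aux_prior u.
  by move=> hQ; exact: sum_aux_output.
have gapE Q : is_cond_pmf Q ->
    info_gap a (V Q) = mutual_info_nats (V Q) - mutual_info_nats a.
  by move=> hQ; apply: info_gapE => // [u y|u]; [exact: V0|exact: Vrow].
have Vmin Q : is_cond_pmf Q -> mutual_info_nats (V Qs) <= mutual_info_nats (V Q).
  move=> hQ; have := Qmin (gp_rate PS W' c Q) (ex_intro2 _ _ Q hQ erefl).
  by rewrite !gp_rateE// ler_pM2r ?invr_gt0 ?ln2_gt0// !gapE// lerD2r.
have Wsum x s y j : 0 <= W (x, s, j) y <= \sum_j W (x, s, j) y.
  have W0 k : 0 <= W (x, s, k) y by have [] := hW (x, s, k).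
  by rewrite W0/= (bigD1 j)//= lerDl sumr_ge0.
have V_unif Q u y : is_cond_pmf Q ->
    t * aux_output PS W unif u y <= V Q u y.
  move=> hQ; rewrite VE// lerDr mulr_ge0 ?subr_ge0 ?(ltW t1)//.
  exact: aux_output_ge0.
have unifE u y : aux_output PS W unif u y =
    #|J|%:R^-1 * \sum_s a u s * \sum_j W (xmap u s, s, j) y.
  rewrite /aux_output mulr_sumr; apply: eq_bigr => s _.
  by rewrite /averaged -mulr_sumr mulrCA.
have avg_le Q x s y : is_cond_pmf Q ->
    averaged W Q x s y <= \sum_j W (x, s, j) y.
  move=> hQ; apply: ler_sum => j _; have [Q0 Q1] := hQ s.
  rewrite ler_piMl//; first by have /andP[] := Wsum x s y j.
  by rewrite -Q1 (bigD1 j)//= lerDl sumr_ge0.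
have V_pos u y : 0 < \sum_s a u s * \sum_j W (xmap u s, s, j) y ->
    0 < V Qs u y.
  move=> H; apply: lt_le_trans (V_unif Qs u y hQs).
  by rewrite mulr_gt0// unifE mulr_gt0// invr_gt0.
have out_pos Q u y : is_cond_pmf Q -> 0 < aux_output PS W Q u y -> 0 < V Qs u y.
  move=> hQ H; apply: V_pos; apply: lt_le_trans H _; apply: ler_sum => s _.
  by rewrite ler_wpM2l// avg_le.
pose iota := density (V Qs).
have opt Q : is_cond_pmf Q -> mutual_info_nats (V Qs) <=
    \sum_u \sum_y V Q u y * ln (iota u y).
  move=> hQ; apply: density_optimal => [u y|u y|u||u y|e e01].
  - exact: V0.
  - exact: V0.
  - by rewrite !Vrow.
  - exact: sum_aux_output1.
  - rewrite VE// => H; have [H1|H1] := ltP 0 (aux_output PS W Q u y).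
      exact: out_pos H1.
    apply: (out_pos unif) => //; rewrite -(pmulr_rgt0 _ t0).
    apply: lt_le_trans H _; rewrite gerDr mulr_ge0_le0// subr_ge0.
    exact: ltW.
  - pose Qe s j := (1 - e) * Qs s j + e * Q s j.
    have hQe : is_cond_pmf Qe.
      move=> s; apply: mix_pmf => //; have /andP[e0 ->] := e01.
      by rewrite ltW.
    rewrite (_ : (fun u y => _) = V Qe); first exact: Vmin.
    apply/funext => u; apply/funext => y; rewrite /V /aux_output !mulr_sumr.
    rewrite -big_split; apply: eq_bigr => s _/=.
    rewrite /averaged mulrCA [e * (_ * _)]mulrCA -mulrDr; congr (_ * _).
    rewrite !mulr_sumr -big_split; apply: eq_bigr => j _/=.
    by rewrite /Qe; ring.
have VQs0 u y : 0 <= V Qs u y by exact: V0.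
have G_unif : \sum_u \sum_y aux_output PS W unif u y * ln (iota u y) <= h.
  rewrite /h; apply: ler_sum => u _.
  have prow : \sum_y aux_output PS W unif u y = aux_prior u.
    exact: sum_aux_output.
  rewrite /xlnx -{1}prow -mulNr -sumrN mulr_suml.
  apply: ler_sum => y _; have := aux_output_ge0 hPS hW u y hunif.
  rewrite le_eqVlt => /predU1P[<- | H]; first by rewrite oppr0 !mul0r.
  rewrite mulNr -mulrN ler_pM2l//.
  have VQ : 0 < V Qs u y by exact: out_pos H.
  have pu : 0 < aux_prior u by rewrite -(Vrow Qs)//; exact: row_gt0 VQ.
  rewrite -lnV ?posrE// ler_ln ?posrE ?invr_gt0//; last exact: density_gt0.
  by rewrite -(Vrow Qs)//; exact: density_le.
(* The mixed channel under [Qs] is the true channel under the admissible kernel [Qt]. *)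
have I0Qs : I0 <= mutual_info_nats (V Qs).
  pose Qt s j := (1 - t) * Qs s j + t * unif s j.
  have hQt : is_cond_pmf Qt by move=> s; exact: mix_pmf.
  apply: le_trans (hI0 Qt hQt) _.
  rewrite le_eqVlt; apply/orP; left; apply/eqP; congr mutual_info_nats.
  apply/funext => u; apply/funext => y; rewrite VE// /aux_output !mulr_sumr.
  rewrite -big_split; apply: eq_bigr => s _/=.
  rewrite /averaged mulrCA [t * (_ * _)]mulrCA -mulrDr; congr (_ * _).
  rewrite !mulr_sumr -big_split; apply: eq_bigr => j _/=.
  by rewrite /Qt; ring.
exists iota; split.
- by move=> u y; exact: density_ge0.
- move=> u s j y H; apply: density_gt0 => //; apply: V_pos.
  apply: (lt_le_trans H); rewrite (bigD1 s)//=.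
  have /andP[_ Wj] := Wsum (xmap u s) s y j.
  rewrite -[leLHS]addr0 lerD ?ler_wpM2l//.
  apply: sumr_ge0 => k _; rewrite mulr_ge0// sumr_ge0// => l _.
  by have /andP[] := Wsum (xmap u k) k y l.
- move=> y; under eq_bigr do rewrite -(Vrow Qs)//.
  exact: density_mass.
- move=> Q hQ; set G := (leRHS).
  have GE : \sum_u \sum_y V Q u y * ln (iota u y) = (1 - t) * G +
      t * \sum_u \sum_y aux_output PS W unif u y * ln (iota u y).
    rewrite /G !mulr_sumr -big_split; apply: eq_bigr => u _/=.
    rewrite !mulr_sumr -big_split; apply: eq_bigr => y _/=.
    by rewrite VE//; ring.
  have H : I0 <= (1 - t) * G + t * h.
    apply: (le_trans I0Qs); apply: le_trans (opt Q hQ) _; rewrite GE.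
    by rewrite lerD2l ler_pM2l.
  have t1' : 0 < 1 - t by rewrite subr_gt0.
  rewrite -(ler_pM2l t1'); apply: (@le_trans _ _ (I0 - t * h)); last first.
    by rewrite lerBlDr.
  have : t * (h - I0 + d) <= d.
    apply: (@le_trans _ _ (t * den)); last by rewrite divfK// gt_eqF.
    rewrite ler_pM2l// /den; have := ler_norm h; have := ler_norm (- I0).
    by rewrite normrN; lra.
  by lra.
Qed.

End DecodingMetric.

(** * One-shot coding and achievability *)

(** Induction from [(1 - x) (1 + (L + 1) x) <= 1 + L x]; a rational substitute for [exp (- L x)]. *)
Lemma bernoulli_inv (R : realType) (x : R) (L : nat) : 0 <= x <= 1 ->
  (1 - x) ^+ L <= (1 + L%:R * x)^-1.
Proof.
move=> /andP[x0 x1].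
have pos k : 0 < 1 + k%:R * x by rewrite ltr_wpDr// mulr_ge0.
rewrite -[leRHS]mul1r ler_pdivlMr//.
elim: L => [|L IH]; first by rewrite expr0 mul0r addr0 mulr1.
apply: le_trans IH; rewrite exprSr -mulrA ler_wpM2l ?exprn_ge0 ?subr_ge0//.
have : 0 <= L%:R * x * x + x * x by rewrite addr_ge0 ?mulr_ge0.
by rewrite -natr1; lra.
Qed.

Lemma sum_swap (R : comPzRingType) (O S J : finType) (m : O -> R) (p : S -> R)
    (Q : S -> J -> R) (F : O -> S -> J -> R) :
  \sum_o m o * (\sum_s p s * \sum_j Q s j * F o s j) =
  \sum_s p s * \sum_j Q s j * \sum_o m o * F o s j.
Proof.
transitivity (\sum_o \sum_s \sum_j p s * (Q s j * (m o * F o s j))).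
  apply: eq_bigr => o _; rewrite mulr_sumr; apply: eq_bigr => s _.
  by rewrite !mulr_sumr; apply: eq_bigr => j _; ring.
rewrite exchange_big; apply: eq_bigr => s _; rewrite exchange_big mulr_sumr.
apply: eq_bigr => j _; rewrite mulr_sumr mulr_sumr.
by apply: eq_bigr => o _.
Qed.

(** * Random coding for one use of an abstract channel, later a whole block *)

Section OneShot.
Context {R : realType} {X S J Y U : finType}.
Variables (p : S -> R) (PU : S -> U -> R) (pU : U -> R) (xm : U -> S -> X).
Variables (w : X -> S -> J -> Y -> R) (iota : U -> Y -> R) (x0 : X).
Variables (N L : nat) (B Z : R).
Hypotheses (hp : is_pmf p) (hPU : is_cond_pmf PU) (hpU : is_pmf pU).
Hypothesis pU_PU : forall s u, pU u = 0 -> PU s u = 0.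
Hypothesis hw : forall x s j, is_pmf (w x s j).
Hypotheses (iota0 : forall u y, 0 <= iota u y).
Hypothesis iota1 : forall y, \sum_u pU u * iota u y <= 1.
Hypotheses (B0 : 0 < B) (Z0 : 0 < Z).

Let PU0 s u : 0 <= PU s u. Proof. by have [] := hPU s. Qed.
Let pU0 u : 0 <= pU u. Proof. by have [] := hpU. Qed.
Let p0 s : 0 <= p s. Proof. by have [] := hp. Qed.
Let w0 x s j y : 0 <= w x s j y. Proof. by have [] := hw x s j. Qed.
Let w1 x s j : \sum_y w x s j y = 1. Proof. by have [] := hw x s j. Qed.

Definition tilt u s : R := PU s u / pU u.

(* A codeword drawn from [pU] and accepted with probability [tilt / B] is
   distributed, up to the factor [B], as if drawn from [PU s]. *)
Definition accept_prob u s : R := if tilt u s <= B then tilt u s / B else 0.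

Let tilt0 u s : 0 <= tilt u s. Proof. exact: divr_ge0. Qed.

Let accept01 u s : 0 <= accept_prob u s <= 1.
Proof.
rewrite /accept_prob; case: ifP => [H|_]; last by rewrite lexx ler01.
by rewrite divr_ge0 ?(ltW B0)//= ler_pdivrMr// mul1r.
Qed.

Let accept_mass u s : pU u * accept_prob u s =
  (if tilt u s <= B then PU s u else 0) / B.
Proof.
rewrite /accept_prob; case: ifP => _; last by rewrite mulr0 mul0r.
rewrite mulrA; congr (_ / _); rewrite /tilt mulrC.
have [u0|u0] := eqVneq (pU u) 0; first by rewrite u0 mulr0 pU_PU.
by rewrite divfK.
Qed.

Let coin u s (b : bool) : R := if b then accept_prob u s else 1 - accept_prob u s.

Let coin_pmf u s : is_pmf (coin u s).
Proof.
have /andP[a0 a1] := accept01 u s; split; first by case; rewrite //= subr_ge0.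
by rewrite big_bool/= addrC subrK.
Qed.

(** A codeword with an acceptance bit for every state, tossed in advance as part of the shared
    randomness: the encoder is then a deterministic function of the book. *)
Let entry := (U * {ffun S -> bool})%type.
Let nu (e : entry) : R := pU e.1 * prodw (coin e.1) e.2.

Let nu_sum (F : U -> R) (G : bool -> R) s :
  \sum_e nu e * (G (e.2 s) * F e.1) = \sum_u pU u * (\sum_b coin u s b * G b) * F u.
Proof.
rewrite -(pair_bigA _ (fun u a => nu (u, a) * (G (a s) * F u)))/=.
apply: eq_bigr => u _; rewrite -(prodw_marginal (p := coin u)).
  by rewrite mulr_sumr mulr_suml; apply: eq_bigr => a _; rewrite /nu/=; ring.
by move=> k; have [] := coin_pmf u k.
Qed.

Let nu_pmf : is_pmf nu.
Proof.
split=> [[u a]|].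
  rewrite /nu mulr_ge0// prodw_ge0// => s b.
  by have [] := coin_pmf u s.
rewrite -(pair_bigA _ (fun u a => nu (u, a)))/=.
have [_ <-] := hpU; apply: eq_bigr => u _.
by rewrite /nu/= -mulr_sumr (sum_prodw1 (coin_pmf u)) mulr1.
Qed.

Let nu_accept (F : U -> R) s : (forall u, 0 <= F u) ->
  \sum_e nu e * ((e.2 s)%:R * F e.1) <= (\sum_u PU s u * F u) / B.
Proof.
move=> F0; rewrite (nu_sum F (fun b => b%:R)) mulr_suml; apply: ler_sum => u _.
rewrite big_bool/= mulr1 mulr0 addr0 accept_mass mulrAC.
by case: ifP => _ //; rewrite mul0r mul0r divr_ge0 ?mulr_ge0// ltW.
Qed.

(** [q s / B] is the probability that one entry is accepted in state [s]. *)
Let q s := \sum_(u | tilt u s <= B) PU s u.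

Let nu_reject s : \sum_e nu e * (~~ e.2 s)%:R = 1 - q s / B.
Proof.
transitivity (\sum_e nu e * ((~~ e.2 s)%:R * (fun=> 1) e.1)).
  by apply: eq_bigr => e _; rewrite mulr1.
rewrite (nu_sum (fun=> 1) (fun b => (~~ b)%:R)); have [_ pU1] := hpU.
rewrite -[in RHS]pU1 /q (big_mkcond (fun u => tilt u s <= B)) mulr_suml -sumrB.
apply: eq_bigr => u _.
by rewrite big_bool/= mulr0 add0r !mulr1 mulrBr mulr1 accept_mass.
Qed.

Let q01 s : 0 <= q s <= 1.
Proof.
rewrite sumr_ge0//=; have [_ <-] := hPU s.
by rewrite [leRHS](bigID (fun u => tilt u s <= B))/= lerDl sumr_ge0.
Qed.

Let qB01 s : 0 <= q s / B <= 1.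
Proof.
have /andP[q0 _] := q01 s; rewrite divr_ge0 ?(ltW B0)//=.
rewrite -subr_ge0 -nu_reject; apply: sumr_ge0 => e _.
by rewrite mulr_ge0//; have [] := nu_pmf.
Qed.

Let index := ('I_N * 'I_L)%type.
Let book := {ffun index -> entry}.
Let mu : book -> R := prodw (fun _ : index => nu).

Let nus (i : index) : \sum_e nu e = 1. Proof. by have [] := nu_pmf. Qed.

Let mu0 om : 0 <= mu om.
Proof. by apply: prodw_ge0 => _ e; have [] := nu_pmf. Qed.

Let mu1 : \sum_om mu om = 1. Proof. exact: sum_prodw1. Qed.

Let encode (om : book) : {ffun 'I_N * S -> X} :=
  [ffun ms : 'I_N * S => if [pick l | (om (ms.1, l)).2 ms.2] is Some l
    then xm (om (ms.1, l)).1 ms.2 else x0].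

Let passes (om : book) i y := Z <= iota (om i).1 y.

Let decode (om : book) : {ffun Y -> option 'I_N} :=
  [ffun y => [pick m | [exists l, passes om (m, l) y]]].

Let bad s j u := \sum_(y | iota u y < Z) w (xm u s) s j y.

(** Union bound: no entry is accepted, the chosen one fails the threshold, or one of another message
    passes it. The second term sums over all accepted entries, not just the chosen one, which makes
    its expectation linear in the entries. *)
Let pointwise om m s j :
  \sum_(y | decode om y != Some m) w (encode om (m, s)) s j y <=
  \prod_l (~~ (om (m, l)).2 s)%:R
  + \sum_l ((om (m, l)).2 s)%:R * bad s j (om (m, l)).1
  + \sum_(i : index | i.1 != m)
      \sum_y w (encode om (m, s)) s j y * (passes om i y)%:R.
Proof.
have bad0 u : 0 <= bad s j u by exact: sumr_ge0.
have acc0 : 0 <= \sum_l ((om (m, l)).2 s)%:R * bad s j (om (m, l)).1.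
  by apply: sumr_ge0 => l _; rewrite mulr_ge0.
have wrong0 x : 0 <= \sum_(i : index | i.1 != m)
    \sum_y w x s j y * (passes om i y)%:R.
  by do 2 (apply: sumr_ge0 => ? _); rewrite mulr_ge0.
have -> : encode om (m, s) =
    if [pick l | (om (m, l)).2 s] is Some l then xm (om (m, l)).1 s else x0.
  by rewrite ffunE.
case: pickP => [l acc|rej]; last first.
  rewrite [X in X + _ + _](_ : _ = 1); last first.
    by rewrite big1// => l _; rewrite rej.
  rewrite -addrA; apply: (@le_trans _ _ 1); last by rewrite lerDl addr_ge0.
  by rewrite -(w1 x0 s j) [leRHS](bigID (fun y => decode om y != Some m))/=
    lerDl sumr_ge0.
rewrite -addrA ler_wpDl ?prodr_ge0//.
apply: (@le_trans _ _ (bad s j (om (m, l)).1 + \sum_(i : index | i.1 != m)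
    \sum_y w (xm (om (m, l)).1 s) s j y * (passes om i y)%:R)); last first.
  rewrite lerD2r (bigD1 l)//= acc mul1r lerDl sumr_ge0// => k _.
  by rewrite mulr_ge0.
rewrite /bad exchange_big/= big_mkcond [X in _ <= X + _]big_mkcond -big_split.
apply: ler_sum => y _ /=; rewrite -mulr_sumr.
have tail0 : 0 <= \sum_(i : index | i.1 != m) (passes om i y)%:R :> R.
  exact: sumr_ge0.
case: ifP => [|_]; last by case: ifP => _; rewrite addr_ge0// mulr_ge0.
rewrite ffunE; case: ltP => [_ _|pass]; first by rewrite lerDl mulr_ge0.
case: pickP => [m' hm' m'm|/(_ m)/= nopass _]; last first.
  by move: nopass => /negbT/existsPn/(_ l); rewrite /passes pass.
have /existsP[l' pass'] := hm'.
rewrite add0r ler_peMr// (bigD1 (m', l'))/=; last first.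
  by apply: contra m'm => /eqP ->.
by rewrite pass' lerDl sumr_ge0.
Qed.

Let E_reject m s :
  \sum_om mu om * \prod_l (~~ (om (m, l)).2 s)%:R = (1 - q s / B) ^+ L.
Proof.
pose h (i : index) (e : entry) : R := if i.1 == m then (~~ e.2 s)%:R else 1.
transitivity (\sum_om prodw (fun i e => nu e * h i e) om).
  apply: eq_bigr => om _.
  have -> : \prod_l (~~ (om (m, l)).2 s)%:R = \prod_i h i (om i).
    rewrite [RHS](_ : _ = \prod_k \prod_l h (k, l) (om (k, l))); last first.
      by rewrite pair_bigA; apply: eq_bigr => -[].
    rewrite [RHS](bigD1 m)//= [X in _ = _ * X]big1 ?mulr1.
      by apply: eq_bigr => l _; rewrite /h eqxx.
    by move=> k /negbTE km; rewrite big1// => l _; rewrite /h/= km.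
  by rewrite -big_split.
rewrite sum_prodw -(pair_bigA _ (fun k l => \sum_e nu e * h (k, l) e))/=.
rewrite (bigD1 m)//= [X in _ * X = _]big1 ?mulr1.
  rewrite -[in RHS](card_ord L) -prodr_const; apply: eq_bigr => l _.
  by rewrite -nu_reject; apply: eq_bigr => e _; rewrite /h eqxx.
move=> k /negbTE km; rewrite big1// => l _; rewrite -[RHS](nus (k, l)).
by apply: eq_bigr => e _; rewrite /h/= km mulr1.
Qed.

Let E_accept m s j :
  \sum_om mu om * \sum_l ((om (m, l)).2 s)%:R * bad s j (om (m, l)).1 <=
  L%:R / B * \sum_u PU s u * bad s j u.
Proof.
under eq_bigr do rewrite mulr_sumr.
rewrite exchange_big/= -mulrA mulr_natl -[in leRHS](card_ord L) -sumr_const.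
apply: ler_sum => l _; rewrite /mu.
rewrite (prodw_marginal (p := fun _ : index => nu) (m, l)
  (fun e => (e.2 s)%:R * bad s j e.1))// [leRHS]mulrC.
by apply: nu_accept => u; exact: sumr_ge0.
Qed.

(** Sending [m] reads only row [m] of the book, so an entry of another row is independent of the
    output, and Markov's inequality applies. *)
Let E_wrong m s j (i : index) : i.1 != m ->
  \sum_om mu om * \sum_y w (encode om (m, s)) s j y * (passes om i y)%:R
  <= Z^-1.
Proof.
move=> im; under eq_bigr do rewrite mulr_sumr.
rewrite exchange_big/=.
have pass_le y : \sum_e nu e * ((Z <= iota e.1 y)%R)%:R <= Z^-1.
  apply: (@le_trans _ _ (\sum_e nu e * (iota e.1 y / Z))).
    apply: ler_sum => e _; apply: ler_wpM2l; first by have [] := nu_pmf.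
    case: (leP Z (iota e.1 y)) => [H|_] /=; last by rewrite divr_ge0 ?(ltW Z0).
    by rewrite ler_pdivlMr// mul1r.
  under eq_bigr do rewrite mulrA.
  rewrite -mulr_suml ler_piMl ?invr_ge0 ?(ltW Z0)//; apply: le_trans (iota1 y).
  rewrite -(pair_bigA _ (fun u a => nu (u, a) * iota u y))/=.
  rewrite le_eqVlt; apply/orP; left; apply/eqP; apply: eq_bigr => u _.
  rewrite -mulr_suml; congr (_ * _); rewrite /nu/= -mulr_sumr.
  by rewrite (sum_prodw1 (coin_pmf u)) mulr1.
apply: (@le_trans _ _ (\sum_y (\sum_om mu om * w (encode om (m, s)) s j y) / Z)).
  apply: ler_sum => y _.
  rewrite (@prodw_indep _ _ _ (fun _ : index => nu) i
    (fun om => w (encode om (m, s)) s j y) (fun e => ((Z <= iota e.1 y)%R)%:R))//.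
    apply: ler_wpM2l => //; apply: sumr_ge0 => om _.
    by rewrite mulr_ge0//; exact: mu0.
  exact: (nus i).
  move=> om e; congr (w _ _ _ _); rewrite !ffunE/=.
  have upd l : update om i e (m, l) = om (m, l).
    by rewrite update_other//; apply: contra im => /eqP <-.
  have updp : (fun l => (update om i e (m, l)).2 s) =1
      (fun l => (om (m, l)).2 s) by move=> l; rewrite upd.
  by rewrite (eq_pick updp); case: pickP => // l _; rewrite upd.
rewrite -mulr_suml exchange_big/=; under eq_bigr do rewrite -mulr_sumr w1 mulr1.
by rewrite mu1 mul1r.
Qed.

(** The terms account for rejection of all entries, truncation of the tilt, failure of an accepted
    codeword, and a wrong codeword passing. The code law is the image of the law of the book. *)
Lemma one_shot_coding :
  exists P : {ffun 'I_N * S -> X} * {ffun Y -> option 'I_N} -> R, is_pmf P /\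
  forall (m : 'I_N) (Q : S -> J -> R), is_cond_pmf Q ->
    \sum_th P th * (\sum_s p s * \sum_j Q s j *
        \sum_(y | th.2 y != Some m) w (th.1 (m, s)) s j y) <=
    (1 + L%:R / B)^-1 + \sum_s p s * (\sum_(u | B < tilt u s) PU s u)
    + L%:R / B * (\sum_s p s * \sum_j Q s j * \sum_u PU s u *
        \sum_(y | iota u y < Z) w (xm u s) s j y)
    + N%:R * L%:R / Z.
Proof.
pose code_of om := (encode om, decode om).
exists (law mu code_of); split.
  split; first by move=> th; exact: law_ge0.
  by rewrite sum_lawT.
move=> m Q hQ; have Q0 s j : 0 <= Q s j by have [] := hQ s.
have Q1 s : \sum_j Q s j = 1 by have [] := hQ s.
have p1 : \sum_s p s = 1 by have [] := hp.
rewrite -(sum_law mu code_of (fun th => \sum_s p s * \sum_j Q s j *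
        \sum_(y | th.2 y != Some m) w (th.1 (m, s)) s j y)).
pose K := L%:R / B.
have K0 : 0 <= K by rewrite divr_ge0// ltW.
have one s j : \sum_om mu om *
    \sum_(y | decode om y != Some m) w (encode om (m, s)) s j y <=
    (1 - q s / B) ^+ L + K * (\sum_u PU s u * bad s j u) + N%:R * L%:R / Z.
  apply: (@le_trans _ _ (\sum_om mu om *
    (\prod_l (~~ (om (m, l)).2 s)%:R
     + \sum_l ((om (m, l)).2 s)%:R * bad s j (om (m, l)).1
     + \sum_(i : index | i.1 != m)
        \sum_y w (encode om (m, s)) s j y * (passes om i y)%:R))).
    by apply: ler_sum => om _; apply: ler_wpM2l.
  under eq_bigr do rewrite !mulrDr.
  rewrite !big_split/= E_reject; apply: lerD; first by rewrite lerD2l E_accept.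
  under eq_bigr do rewrite mulr_sumr.
  rewrite exchange_big/=.
  apply: (@le_trans _ _ (\sum_(i : index | i.1 != m) Z^-1)).
    by apply: ler_sum => i im; exact: E_wrong.
  apply: (@le_trans _ _ (\sum_(i : index) Z^-1)).
    rewrite [leRHS](bigID (fun i : index => i.1 != m))/= lerDl sumr_ge0// => i _.
    by rewrite invr_ge0 ltW.
  by rewrite sumr_const card_prod !card_ord -natrM mulr_natl.
apply: (@le_trans _ _ (\sum_s p s * \sum_j Q s j * ((1 - q s / B) ^+ L
    + K * (\sum_u PU s u * bad s j u) + N%:R * L%:R / Z))).
  rewrite (sum_swap mu p Q (fun om s j =>
    \sum_(y | decode om y != Some m) w (encode om (m, s)) s j y)).
  apply: ler_sum => s _; apply: ler_wpM2l => //.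
  by apply: ler_sum => j _; apply: ler_wpM2l.
have split s : \sum_j Q s j * ((1 - q s / B) ^+ L
    + K * (\sum_u PU s u * bad s j u) + N%:R * L%:R / Z) =
    (1 - q s / B) ^+ L + K * (\sum_j Q s j * \sum_u PU s u * bad s j u)
    + N%:R * L%:R / Z.
  under eq_bigr do rewrite !mulrDr.
  rewrite !big_split/= -!mulr_suml Q1 !mul1r; congr (_ + _ + _).
  by rewrite mulr_sumr; apply: eq_bigr => j _; rewrite mulrCA.
under eq_bigr do rewrite split !mulrDr.
rewrite !big_split/= -mulr_suml p1 mul1r lerD2r; apply: lerD; last first.
  rewrite le_eqVlt; apply/orP; left; apply/eqP; rewrite mulr_sumr.
  by apply: eq_bigr => s _; rewrite mulrCA.
have cst_p x : x = \sum_s p s * x by rewrite -mulr_suml p1 mul1r.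
rewrite [X in _ <= X + _]cst_p -big_split/=; apply: ler_sum => s _.
rewrite -mulrDr; apply: ler_wpM2l => //.
have /andP[q0 q1] := q01 s; have /andP[qB0 qB1] := qB01 s.
have -> : \sum_(u | B < tilt u s) PU s u = 1 - q s.
  apply: (addIr (q s)); rewrite subrK; have [_ <-] := hPU s.
  rewrite [RHS](bigID (fun u => tilt u s <= B))/= addrC; congr (_ + _).
  by apply: eq_bigl => u; rewrite ltNge.
(* Since [L (q s / B) = K q s], it remains to see [1 / (1 + K q) <= 1 / (1 + K) + (1 - q)], which
   splits off the truncated mass [1 - q]. *)
apply: le_trans (bernoulli_inv _ (qB01 s)) _.
rewrite mulrCA [_ * (_ / _)](_ : _ = K * q s); last by rewrite /K; ring.
have Kq : 0 < 1 + K * q s.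
  by apply: ltr_wpDr => //; apply: mulr_ge0.
have K1 : 0 < 1 + K by rewrite ltr_wpDr.
rewrite -[leLHS]mul1r ler_pdivrMr// -(ler_pM2l K1) mulr1.
have -> : (1 + K) * (((1 + K)^-1 + (1 - q s)) * (1 + K * q s)) =
    (1 + K) + (1 - q s) * (1 + K * q s + K * K * q s).
  by field; rewrite gt_eqF.
rewrite lerDl; apply: mulr_ge0; first by rewrite subr_ge0.
by apply: addr_ge0; [exact: ltW|apply: mulr_ge0 => //; exact: mulr_ge0].
Qed.

End OneShot.

(** * Concentration over blocks and achievability *)

Lemma le_sum_norm (R : realType) (T : finType) (f : T -> R) t :
  `|f t| <= \sum_t `|f t|.
Proof. by rewrite (bigD1 t)//= lerDl sumr_ge0. Qed.

Lemma sum_zip (R : realType) (I A B : finType)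
    (F : {ffun I -> A} -> {ffun I -> B} -> R) :
  \sum_v \sum_w F v w =
  \sum_(z : {ffun I -> A * B}) F [ffun k => (z k).1] [ffun k => (z k).2].
Proof.
rewrite pair_bigA/=.
pose h (z : {ffun I -> A * B}) := ([ffun k => (z k).1], [ffun k => (z k).2]) :
  {ffun I -> A} * {ffun I -> B}.
rewrite (reindex h)//.
exists (fun vw : {ffun I -> A} * {ffun I -> B} => [ffun k => (vw.1 k, vw.2 k)]).
  by move=> z _; apply/ffunP => k; rewrite !ffunE/=; case: (z k).
move=> [v w] _; rewrite /h/=; congr pair; apply/ffunP => k; by rewrite !ffunE.
Qed.

(** The event has to lie in the lower tail only at points of positive probability, since only there
    is [ln] of a density meaningful. *)
Lemma chebyshev_pair (R : realType) (A B : finType) (n : nat)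
    (p f : 'I_n -> A * B -> R) (M d : R)
    (E : {ffun 'I_n -> A} -> {ffun 'I_n -> B} -> bool) :
  (0 < n)%N -> 0 < d -> (forall k, is_pmf (p k)) ->
  (forall k a, `|f k a| <= M) ->
  (forall (v : {ffun 'I_n -> A}) (w : {ffun 'I_n -> B}),
    (forall k, 0 < p k (v k, w k)) -> E v w ->
    \sum_k f k (v k, w k) <= \sum_k \sum_a p k a * f k a - n%:R * d) ->
  \sum_(v : {ffun 'I_n -> A}) \sum_(w : {ffun 'I_n -> B} | E v w)
    \prod_k p k (v k, w k) <= M ^+ 2 / (n%:R * d ^+ 2).
Proof.
move=> n0 d0 hp hf hE; apply: le_trans (chebyshev_prodw n0 d0 hp hf).
have p0 k a : 0 <= p k a by have [] := hp k.
under eq_bigr do rewrite big_mkcond.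
rewrite sum_zip [leRHS]big_mkcond; apply: ler_sum => z _.
have zE k : ([ffun k => (z k).1] k, [ffun k => (z k).2] k) = z k.
  by rewrite !ffunE -surjective_pairing.
rewrite (eq_bigr (fun k => p k (z k))) => [|k _]; last by rewrite zE.
rewrite -/(prodw p z); have z0 := prodw_ge0 z p0.
case: ifP => [Ez|_]; last by case: ifP.
have [pz|pz] := boolP [forall k, 0 < p k (z k)].
  rewrite (_ : (_ <= _ - _) = true) ?lexx//.
  have := hE _ _ _ Ez; under eq_bigr do rewrite zE.
  by apply=> k; rewrite zE; exact: (forallP pz).
have [k pk] := existsP (etrans (esym (negb_forall _)) pz).
rewrite /prodw (bigD1 k)//= (_ : p k (z k) = 0) ?mul0r; last first.
  by apply/eqP; rewrite eq_le p0 andbT leNgt.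
by case: ifP.
Qed.

Lemma mutual_info_nats_ge0 (R : realType) (U Y : finType) (P : U -> Y -> R) :
  (forall u y, 0 <= P u y) -> \sum_u \sum_y P u y = 1 -> 0 <= mutual_info_nats P.
Proof.
move=> P0 P1; rewrite -oppr_le0 /mutual_info_nats pair_bigA/= -sumrN.
have H : \sum_(z : U * Y) P z.1 z.2 * ln (density P z.1 z.2)^-1 <= 0.
  apply: gibbs => [z|z Pz|]; first exact: P0.
    by rewrite invr_gt0; exact: density_gt0.
  rewrite -(pair_bigA _ (fun u y => P u y))/= P1.
  rewrite -(pair_bigA _ (fun u y => P u y * (density P u y)^-1))/=.
  apply: (@le_trans _ _ (\sum_u \sum_y (\sum_y' P u y') * \sum_u' P u' y)).
    apply: ler_sum => u _; apply: ler_sum => y _.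
    have := P0 u y; rewrite le_eqVlt => /predU1P[<- | Puy].
      by rewrite mul0r mulr_ge0 ?sumr_ge0.
    by rewrite /density invf_div mulrCA divff ?gt_eqF// mulr1.
  under eq_bigr do rewrite -mulr_sumr.
  by rewrite -mulr_suml P1 mul1r exchange_big P1.
apply: le_trans H; apply: ler_sum => z _.
have := P0 z.1 z.2; rewrite le_eqVlt => /predU1P[<- | Puy].
  by rewrite !mul0r oppr0.
by rewrite lnV ?mulrN// posrE density_gt0.
Qed.

Section ErrorProb.
Context {R : realType} {X Y S J : finType}.
Variables (PS : S -> R) (W : X * S * J -> Y -> R).

Lemma error_probE n N (P : @Defs.code X Y S n N -> R) m Q :
  error_prob PS W P m Q =
  \sum_th P th * (\sum_s iid PS s * \sum_j Q s j *
    \sum_(y | th.2 y != Some m) memoryless W (th.1 (m, s)) s j y).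
Proof.
rewrite /error_prob big_mkcond/=.
transitivity (\sum_(th : @Defs.code X Y S n N) \sum_(s : word n S)
    \sum_(j : word n J) \sum_(y : word n Y)
  (if th.2 y != Some m then transmission PS W P m Q (th, s, j, y) else 0)).
  by rewrite !pair_bigA; apply: eq_bigr => -[[[th s] j] y] _.
apply: eq_bigr => th _; rewrite mulr_sumr; apply: eq_bigr => s _.
rewrite mulrA mulr_sumr; apply: eq_bigr => j _.
rewrite mulrA mulr_sumr [RHS]big_mkcond; apply: eq_bigr => y _.
by case: ifP => _.
Qed.

End ErrorProb.

Section Achievability.
Context {R : realType} {X Y S J : finType}.
Variables (PS : S -> R) (W : X * S * J -> Y -> R).
Hypotheses (hX : (0 < #|X|)%N) (hJ : (0 < #|J|)%N).
Hypotheses (hPS : is_pmf PS) (PS0 : forall s, 0 < PS s) (hW : is_cond_pmf W).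
Variable c : gp_input R X S.

Local Notation a := (aux_state PS (c := c)).
Local Notation law1 := (aux_law c).
Local Notation xmap := (input_map c).
Local Notation pU := (aux_prior PS (c := c)).

Let a0 u s : 0 <= a u s. Proof. exact: aux_state_ge0. Qed.
Let law10 s u : 0 <= law1 s u. Proof. by have [] := aux_lawP c s. Qed.
Let W0 z y : 0 <= W z y. Proof. by have [] := hW z. Qed.
Let pU0 u : 0 <= pU u. Proof. exact: sumr_ge0. Qed.

(** Positivity of [PS] enters here: no state of mass zero can hide a value of [U]. *)
Let pU_law u s : pU u = 0 -> law1 s u = 0.
Proof.
move/eqP; rewrite psumr_eq0// => /allP/(_ s); rewrite mem_index_enum => /(_ isT).
by rewrite mulf_eq0 gt_eqF// => /eqP.
Qed.

Let density_state u s : density a u s = law1 s u / pU u.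
Proof.
rewrite /density sum_aux_state -/(pU u) /aux_state [pU u * _]mulrC invfM.
by rewrite mulrACA mulfV ?mul1r// gt_eqF.
Qed.

(** [I(U;S)] in nats, the exponent of the number of codewords spent on each message. *)
Definition state_gap : R := mutual_info_nats a.

Lemma state_gap_ge0 : 0 <= state_gap.
Proof. by apply: mutual_info_nats_ge0 => //; exact: sum_aux. Qed.

Section Block.
Variables (n : nat).
Hypothesis n0 : (0 < n)%N.
Variable d : R.
Hypothesis d0 : 0 < d.

Definition aux_laws (s : word n S) (u : word n (aux c)) : R :=
  prodw (fun k => law1 (s k)) u.

Definition priors (u : word n (aux c)) : R := prodw (fun=> pU) u.

Definition inputs (u : word n (aux c)) (s : word n S) : word n X :=
  [ffun k => xmap (u k) (s k)].

Let nd0 : 0 < n%:R * d ^+ 2 :> R.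
Proof. by rewrite mulr_gt0 ?ltr0n ?exprn_gt0. Qed.

Definition state_bound : R := \sum_z `|ln (density a z.2 z.1)|.

Lemma tilt_tail :
  \sum_s iid PS s * (\sum_(u | expR (n%:R * (state_gap + d)) <
     tilt aux_laws priors u s) aux_laws s u)
  <= state_bound ^+ 2 / (n%:R * d ^+ 2).
Proof.
pose p (k : 'I_n) (z : S * aux c) := a z.2 z.1.
(* Negated because Chebyshev's inequality is stated for the lower tail. *)
pose f (k : 'I_n) (z : S * aux c) := - ln (density a z.2 z.1).
have hp k : is_pmf (p k).
  split=> [z|]; first exact: a0.
  by rewrite -(pair_bigA _ (fun s u => a u s))/= exchange_big; exact: sum_aux.
have hf k z : `|f k z| <= state_bound.
  rewrite /f normrN.
  exact: (le_sum_norm (fun z : S * aux c => ln (density a z.2 z.1)) z).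
apply: le_trans (chebyshev_pair (E := fun s u => expR (n%:R * (state_gap + d)) <
  tilt aux_laws priors u s) n0 d0 hp hf _).
  apply: ler_sum => s _; rewrite mulr_sumr; apply: ler_sum => u _.
  by rewrite /iid /aux_laws /prodw -big_split.
move=> s u suk; rewrite /tilt => E.
have law_gt0 k : 0 < law1 (s k) (u k).
  by have := suk k; rewrite /p/= /aux_state pmulr_rgt0.
have pU_gt0 k : 0 < pU (u k).
  rewrite lt_def pU0 andbT; apply/eqP => /(pU_law (s k)) H.
  by have := law_gt0 k; rewrite H ltxx.
have dens : aux_laws s u / priors u = \prod_k density a (u k) (s k).
  rewrite /aux_laws /priors /prodw -prodf_div; apply: eq_bigr => k _.
  by rewrite density_state.
have dens_gt0 k : 0 < density a (u k) (s k) by rewrite density_state divr_gt0.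
have lnE : n%:R * (state_gap + d) < \sum_k ln (density a (u k) (s k)).
  rewrite -ltr_expR; apply: lt_le_trans E _; rewrite dens expR_sum.
  by apply: ler_prod => k _; rewrite ltW//= lnK ?posrE.
have mean k : \sum_z p k z * f k z = - state_gap.
  rewrite /state_gap /mutual_info_nats exchange_big pair_bigA/= -sumrN.
  by apply: eq_bigr => -[s' u'] _; rewrite /p /f/= mulrN.
under [X in _ <= X - _]eq_bigr do rewrite mean.
rewrite sumr_const card_ord -[(- state_gap) *+ n]mulr_natl /f sumrN/= mulrN.
by move: lnE; rewrite mulrDr; lra.
Qed.

Variables (iota : aux c -> Y -> R) (I0 : R).
Hypothesis iota0 : forall u y, 0 <= iota u y.
Hypothesis iota_gt0 :
  forall u s j y, 0 < a u s * W (xmap u s, s, j) y -> 0 < iota u y.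
Hypothesis iota1 : forall y, \sum_u pU u * iota u y <= 1.
Hypothesis iotaI : forall Q, is_cond_pmf Q ->
  I0 - d <= \sum_u \sum_y aux_output PS W Q u y * ln (iota u y).

Definition metric (u : word n (aux c)) (y : word n Y) : R :=
  \prod_k iota (u k) (y k).

Definition metric_bound : R := \sum_z `|ln (iota z.1 z.2)|.

Definition mean_metric s j : R :=
  \sum_(z : aux c * Y) law1 s z.1 * W (xmap z.1 s, s, j) z.2 * ln (iota z.1 z.2).

Definition worst (j0 : J) s : J := [arg min_(j < j0) mean_metric s j]%O.

Lemma worst_min j0 s j : mean_metric s (worst j0 s) <= mean_metric s j.
Proof. by rewrite /worst; case: arg_minP => // i _; apply. Qed.

(** Choosing the worst letter for each state is itself a kernel, so [iotaI] covers it. *)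
Lemma worst_mean j0 : I0 - d <= \sum_s PS s * mean_metric s (worst j0 s).
Proof.
have := iotaI (fun s => dirac_pmf (worst j0 s)).
move=> /le_trans; apply; rewrite le_eqVlt; apply/orP; left; apply/eqP.
rewrite pair_bigA/=; under [RHS]eq_bigr do rewrite mulr_sumr.
rewrite [RHS]exchange_big; apply: eq_bigr => -[u y] _ /=.
rewrite /aux_output mulr_suml; apply: eq_bigr => s _.
rewrite /averaged (bigD1 (worst j0 s))//= eqxx mul1r [X in _ + X]big1 ?addr0.
  by rewrite /aux_state; ring.
by move=> j /negbTE ->; rewrite mul0r.
Qed.

Definition mean_bound (j0 : J) : R := \sum_s `|mean_metric s (worst j0 s)|.

(** However [j] depends on [s], given both vectors the pairs [(U_k, Y_k)] are independent.
    Chebyshev's inequality is applied to the worst means over the states, then to the metric given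
    [(s, j)]; with [iotaI], each of the three steps costs one [d]. *)
Lemma metric_tail j0 (Q : word n S -> word n J -> R) : is_cond_pmf Q ->
  \sum_s iid PS s * \sum_j Q s j * \sum_u aux_laws s u *
    (\sum_(y | metric u y < expR (n%:R * (I0 - 3 * d)))
        memoryless W (inputs u s) s j y)
  <= (mean_bound j0 ^+ 2 + metric_bound ^+ 2) / (n%:R * d ^+ 2).
Proof.
move=> hQ; pose Z := expR (n%:R * (I0 - 3 * d)).
pose p (s : word n S) (j : word n J) (k : 'I_n) (z : aux c * Y) :=
  law1 (s k) z.1 * W (xmap z.1 (s k), s k, j k) z.2.
pose f (k : 'I_n) (z : aux c * Y) := ln (iota z.1 z.2).
have hp s j k : is_pmf (p s j k).
  split=> [z|]; first by rewrite mulr_ge0.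
  rewrite -(pair_bigA _ (fun u y => p s j k (u, y)))/=.
  have [_ <-] := aux_lawP c (s k); apply: eq_bigr => u _.
  by rewrite /p/= -mulr_sumr; have [_ ->] := hW (xmap u (s k), s k, j k);
    rewrite mulr1.
have hf k z : `|f k z| <= metric_bound.
  exact: (le_sum_norm (fun z : aux c * Y => ln (iota z.1 z.2)) z).
have pE s j u y : aux_laws s u * memoryless W (inputs u s) s j y =
    \prod_k p s j k (u k, y k).
  rewrite /aux_laws /memoryless /prodw -big_split; apply: eq_bigr => k _ /=.
  by rewrite ffunE.
pose inner s j := \sum_u aux_laws s u *
    (\sum_(y | metric u y < Z) memoryless W (inputs u s) s j y).
have innerE s j : inner s j =
    \sum_(u : word n (aux c)) \sum_(y : word n Y | metric u y < Z)
      \prod_k p s j k (u k, y k).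
  apply: eq_bigr => u _; rewrite mulr_sumr; apply: eq_bigr => y _.
  exact: pE.
have p0 s j k z : 0 <= p s j k z by have [] := hp s j k.
have inner1 s j : inner s j <= 1.
  rewrite innerE; have total : \sum_(u : word n (aux c)) \sum_(y : word n Y)
      \prod_k p s j k (u k, y k) = 1.
    rewrite sum_zip -[RHS](sum_prodw1 (hp s j)); apply: eq_bigr => z _.
    by apply: eq_bigr => k _; rewrite !ffunE -surjective_pairing.
  rewrite -[leRHS]total; apply: ler_sum => u _; rewrite big_mkcond.
  apply: ler_sum => y _; case: ifP => // _.
  by apply: prodr_ge0 => k _.
pose low (s : word n S) := \sum_k mean_metric (s k) (worst j0 (s k)).
(* [typ] marks the exceptional state vectors, those whose worst means are too low. *)
pose typ (s : word n S) :=
  low s <= \sum_(k < n) \sum_s PS s * mean_metric s (worst j0 s) - n%:R * d.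
have atyp s j : ~~ typ s -> inner s j <= metric_bound ^+ 2 / (n%:R * d ^+ 2).
  rewrite -ltNge => tys; rewrite innerE.
  apply: (chebyshev_pair (E := fun u y => metric u y < Z) n0 d0 (hp s j) hf).
  move=> u y uyk E.
  have ik k : 0 < iota (u k) (y k).
    apply: (@iota_gt0 _ (s k) (j k)); have := uyk k.
    rewrite /p/= => H; rewrite /aux_state -mulrA mulr_gt0//.
  have lnE : \sum_k ln (iota (u k) (y k)) < n%:R * (I0 - 3 * d).
    rewrite -ltr_expR; apply: le_lt_trans E; rewrite expR_sum /metric.
    by apply: ler_prod => k _; rewrite expR_ge0/= lnK ?posrE.
  have mean : \sum_(k < n) \sum_s PS s * mean_metric s (worst j0 s) - n%:R * d
      < \sum_k \sum_z p s j k z * f k z.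
    by apply: lt_le_trans tys _; apply: ler_sum => k _; exact: worst_min.
  have := worst_mean j0; rewrite -(ler_pM2l (x := n%:R)) ?ltr0n//.
  move: mean lnE; rewrite sumr_const card_ord -[(\sum_s _) *+ n]mulr_natl /f/=.
  by lra.
have iid0 s : 0 <= iid PS s by apply: prodr_ge0 => k _; exact: ltW.
have [_ iid1] := is_pmf_prodw (p := fun _ : 'I_n => PS) (fun=> hPS).
rewrite -/(iid PS) in iid1.
apply: (@le_trans _ _ (\sum_s iid PS s * ((typ s)%:R +
    metric_bound ^+ 2 / (n%:R * d ^+ 2)))).
  apply: ler_sum => s _; apply: ler_wpM2l => //.
  have [Q0 Q1] := hQ s.
  have cst_Q x : x = \sum_j Q s j * x by rewrite -mulr_suml Q1 mul1r.
  rewrite [leRHS]cst_Q.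
  apply: ler_sum => j _; apply: ler_wpM2l => //.
  have [ty|ty] := boolP (typ s); last first.
    by rewrite add0r; exact: atyp.
  apply: (le_trans (inner1 s j)); rewrite lerDl divr_ge0 ?sqr_ge0//.
  exact: ltW.
under eq_bigr do rewrite mulrDr.
rewrite big_split/= -mulr_suml iid1 mul1r mulrDl lerD2r.
have hlow (k : 'I_n) s : `|mean_metric s (worst j0 s)| <= mean_bound j0.
  exact: (le_sum_norm (fun s => mean_metric s (worst j0 s)) s).
have := @chebyshev_prodw R S n (fun=> PS)
  (fun _ s => mean_metric s (worst j0 s)) _ d n0 d0 (fun=> hPS) hlow.
apply: le_trans; rewrite [leRHS]big_mkcond; apply: ler_sum => s _.
rewrite -/(low s) -/(typ s); case: (typ s); by rewrite ?mulr1 ?mulr0.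
Qed.

End Block.

Lemma achievability (C r : R) : r < C ->
  (forall Q, is_cond_pmf Q -> C <= gp_rate PS W c Q) ->
  forall eps, 0 < eps -> exists n0 : nat, forall n N : nat, (n0 < n)%N ->
    N%:R = 2 `^ (n%:R * r) -> exists P : @Defs.code X Y S n N -> R,
      is_pmf P /\ max_error_prob PS W P < eps.
Proof.
move=> rC hC eps eps0.
have ln20 := ln2_gt0 (R := R).
pose I0 := C * ln 2 + state_gap.
(* Per letter, [N L / Z] has exponent [r ln 2 + (I(U;S) + d) - (I0 - 3 d) = - 5 d + 4 d = - d]. *)
pose d := (C - r) * ln 2 / 5.
have d0 : 0 < d by rewrite divr_gt0// mulr_gt0// subr_gt0.
have hI0 Q : is_cond_pmf Q -> I0 <= mutual_info_nats (aux_output PS W (c := c) Q).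
  move=> hQ; have := hC Q hQ; rewrite gp_rateE// ler_pdivlMr// info_gapE//.
  - by rewrite lerBrDr.
  - by move=> u y; exact: aux_output_ge0.
  - by move=> u; exact: sum_aux_output.
have [iota [iota0 iota_gt0 iota1 iotaI]] := decoding_metric hJ hPS hW d0 hI0.
have [j0 _] := card_gt0P hJ.
have [x0 _] := card_gt0P hX.
(* [K] is fixed before [n]; rejection of all entries then costs less than [eps / 2]. *)
pose K := (Num.truncn (2 / eps)).+1.
have K_eps : (1 + K%:R)^-1 < eps / 2 :> R.
  have H : 2 / eps < K%:R by rewrite truncnS_gt.
  rewrite -[eps / 2]invrK ltf_pV2 ?posrE ?invr_gt0 ?divr_gt0 ?addr_gt0//.
  by rewrite invf_div (lt_trans H)// ltrDr.
pose Atot := state_bound ^+ 2 / d ^+ 2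
  + (1 + K%:R) * ((mean_bound iota j0 ^+ 2 + metric_bound iota ^+ 2) / d ^+ 2)
  + (1 + K%:R) / d.
have Atot0 : 0 <= Atot.
  have d0' := ltW d0.
  by rewrite /Atot; do ![exact: d0'|exact: sqr_ge0|exact: ler0n|exact: ler01|
    apply: addr_ge0|apply: divr_ge0|apply: mulr_ge0].
exists (Num.truncn (2 * Atot / eps)).+1 => n N nn NE.
have n0 : (0 < n)%N by exact: leq_ltn_trans nn.
have nR0 : 0 < n%:R :> R by rewrite ltr0n.
have nA : Atot / n%:R < eps / 2.
  rewrite ltr_pdivrMr// mulrC -ltr_pdivrMr ?divr_gt0// invf_div.
  rewrite [X in X < _](_ : _ = 2 * Atot / eps); last by ring.
  apply: lt_trans (truncnS_gt _) _.
  by rewrite ltr_nat.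
pose B := expR (n%:R * (state_gap + d)).
pose Z := expR (n%:R * (I0 - 3 * d)).
have B0 : 0 < B by exact: expR_gt0.
have Z0 : 0 < Z by exact: expR_gt0.
have B1 : 1 <= B.
  by rewrite -expR0 ler_expR mulr_ge0// addr_ge0 ?state_gap_ge0 ?ltW.
(* As [B >= 1], [K B < L <= (1 + K) B]: enough entries for acceptance, and [L / B] stays bounded in
   [n]. *)
pose L := (Num.truncn (K%:R * B)).+1.
have KL : K%:R * B < L%:R by rewrite truncnS_gt.
have LK : L%:R <= (1 + K%:R) * B.
  rewrite /L -natr1 mulrDl mul1r addrC lerD//.
  by rewrite truncn_le mulr_ge0 ?ltW.
have pU_pmf : is_pmf pU by split => //; exact: sum_aux_prior.
have tiltP s u : priors u = 0 -> aux_laws s u = 0.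
  move=> /eqP; rewrite /priors /prodw => /prodf_eq0[k _ /eqP uk].
  by rewrite /aux_laws /prodw (bigD1 k)//= pU_law// mul0r.
have iota1n y : \sum_u priors u * metric iota u y <= 1.
  rewrite (_ : \sum_u _ = \sum_u prodw (fun k u => pU u * iota u (y k)) u).
    rewrite sum_prodw; apply: prodr_ile1 => k _.
    by rewrite iota1 sumr_ge0// => u _; rewrite mulr_ge0.
  by apply: eq_bigr => u _; rewrite /priors /metric /prodw -big_split.
have memo x s j : is_pmf (memoryless W x s j : word n Y -> R).
  by apply: (@is_pmf_prodw _ _ _ (fun i => W (x i, s i, j i))) => i; exact: hW.
have iidP : is_pmf (@iid R S PS n).
  exact: (@is_pmf_prodw _ _ _ (fun=> PS)).
have lawsP : is_cond_pmf (@aux_laws n).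
  by move=> s; apply: is_pmf_prodw => k; exact: aux_lawP.
have priorsP : is_pmf (@priors n) by exact: is_pmf_prodw.
have metric0 u y : 0 <= metric iota u y :> R by exact: prodr_ge0.
have [P [hP HP]] := @one_shot_coding R (word n X) (word n S) (word n J)
  (word n Y) (word n (aux c)) (@iid R S PS n) (@aux_laws n) (@priors n) (@inputs n)
  (@memoryless R X Y S J W n) (@metric n iota) [ffun=> x0] N L B Z
  iidP lawsP priorsP (@tiltP n) memo (@metric0 n) (@iota1n n) B0 Z0.
exists P; split => //.
have N0 : (0 < N)%N by rewrite -(ltr_nat R) NE powR_gt0.
pose jam (_ : word n S) (j : word n J) : R := (j == [ffun=> j0])%:R.
have jamP : is_cond_pmf jam.
  by move=> s; exact: (@dirac_pmf R (word n J) [ffun=> j0]).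
apply: (@le_lt_trans _ _ (eps / 2 + Atot / n%:R)); last by move: nA; lra.
apply: ge_sup.
  exists (error_prob PS W P (Ordinal N0) jam).
  by exists (Ordinal N0), jam.
move=> _ [m [Q [hQ ->]]]; rewrite error_probE.
apply: (le_trans (HP m Q hQ)).
have LB : L%:R / B <= 1 + K%:R by rewrite ler_pdivrMr.
have E1 : (1 + L%:R / B)^-1 <= eps / 2.
  apply: le_trans (ltW K_eps); rewrite lef_pV2 ?posrE; last 2 first.
  - by rewrite addr_gt0// divr_gt0// (le_lt_trans _ KL) ?mulr_ge0 ?ltW.
  - by rewrite addr_gt0// ltr0n.
  by rewrite lerD2l ler_pdivlMr// ltW.
have E2 := tilt_tail n0 d0.
have E3 := metric_tail n0 d0 iota_gt0 iotaI j0 hQ.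
have E4 : N%:R * L%:R / Z <= (1 + K%:R) / d / n%:R.
  have NLE : N%:R * L%:R / Z <= (1 + K%:R) * expR (- (n%:R * d)).
    rewrite ler_pdivrMr//; apply: (@le_trans _ _ (N%:R * ((1 + K%:R) * B))).
      by rewrite ler_wpM2l.
    rewrite mulrCA -mulrA; apply: ler_wpM2l; first by rewrite addr_ge0.
    rewrite NE /powR pnatr_eq0/= -!expRD ler_expR /I0 /d.
    by rewrite le_eqVlt; apply/orP; left; apply/eqP; field.
  apply: le_trans NLE _; rewrite -!mulrA ler_wpM2l ?addr_ge0//.
  rewrite -invfM expRN [d * _]mulrC lef_pV2 ?posrE; last 2 first.
  - exact: expR_gt0.
  - exact: mulr_gt0.
  by apply: le_trans (expR_ge1Dx _); rewrite lerDr.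
have K0 : 0 <= 1 + K%:R :> R by rewrite addr_ge0.
have E3' : L%:R / B * (\sum_s iid PS s * \sum_j Q s j * \sum_u aux_laws s u *
    (\sum_(y | metric iota u y < Z) memoryless W (inputs u s) s j y)) <=
    (1 + K%:R) * ((mean_bound iota j0 ^+ 2 + metric_bound iota ^+ 2)
      / (n%:R * d ^+ 2)).
  apply: le_trans (_ : _ <= (1 + K%:R) * _) _; last by apply: ler_wpM2l E3.
  apply: ler_wpM2r => //; apply: sumr_ge0 => s _.
  have [Q0 _] := hQ s; have [i0 _] := iidP; rewrite mulr_ge0//.
  apply: sumr_ge0 => j _; rewrite mulr_ge0//; apply: sumr_ge0 => u _.
  have [l0 _] := lawsP s; rewrite mulr_ge0// sumr_ge0// => y _.
  by have [m0 _] := memo (inputs u s) s j.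
rewrite [leRHS](_ : _ = eps / 2 + state_bound ^+ 2 / (n%:R * d ^+ 2)
   + (1 + K%:R) * ((mean_bound iota j0 ^+ 2 + metric_bound iota ^+ 2)
      / (n%:R * d ^+ 2)) + (1 + K%:R) / d / n%:R).
  by rewrite !lerD.
by rewrite /Atot; field; rewrite !gt_eqF.
Qed.

End Achievability.

(** * Converse *)

Section LawMarginals.
Context {R : realType} {T : finType} (p : T -> R).
Hypothesis p0 : forall t, 0 <= p t.

Lemma law_pair_suml (A B : finType) (f : T -> A) (g : T -> B) b :
  \sum_a law p (fun t => (f t, g t)) (a, b) = law p g b.
Proof.
under eq_bigr do rewrite lawE.
rewrite exchange_big lawE; apply: eq_bigr => t _ /=.
rewrite -mulr_sumr; congr (_ * _).
rewrite (bigD1 (f t))//= [X in _ + X]big1 ?addr0 ?xpair_eqE ?eqxx//.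
by move=> a /negbTE fa; rewrite xpair_eqE [f t == a]eq_sym fa.
Qed.

Lemma law_same (A B : finType) (f : T -> A) (g : T -> B) t :
  (forall t' , (f t' == f t) = (g t' == g t)) -> law p f (f t) = law p g (g t).
Proof. by move=> fg; apply: eq_bigl => t'; rewrite fg. Qed.

Lemma info_gap_law (A B C : finType) (f : T -> A) (g : T -> B) (h : T -> C) :
  info_gap (fun a b => law p (fun t => (f t, g t)) (a, b))
    (fun a c => law p (fun t => (f t, h t)) (a, c)) =
  \sum_t p t * (ln (law p (fun t => (f t, h t)) (f t, h t)) - ln (law p h (h t))
    - ln (law p (fun t => (f t, g t)) (f t, g t)) + ln (law p g (g t))).
Proof.
transitivity (\sum_t p t * ln (law p (fun t => (f t, h t)) (f t, h t))
  - \sum_t p t * ln (law p h (h t))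
  - \sum_t p t * ln (law p (fun t => (f t, g t)) (f t, g t))
  + \sum_t p t * ln (law p g (g t))); last first.
  by rewrite -!sumrB -big_split/=; apply: eq_bigr => t _; ring.
have E (D : finType) (k : T -> D) := sum_law p k (fun a => ln (law p k a)).
rewrite !E /info_gap; congr (_ - _ - _ + _).
- by rewrite pair_bigA; apply: eq_bigr => -[].
- by apply: eq_bigr => c _; rewrite law_pair_suml.
- by rewrite pair_bigA; apply: eq_bigr => -[].
- by apply: eq_bigr => b _; rewrite law_pair_suml.
Qed.

End LawMarginals.

Section Converse.
Context {R : realType} {X Y S J : finType}.
Variables (PS : S -> R) (W : X * S * J -> Y -> R).
Hypotheses (hX : (0 < #|X|)%N) (hJ : (0 < #|J|)%N).
Hypotheses (hPS : is_pmf PS) (PS0 : forall s, 0 < PS s) (hW : is_cond_pmf W).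
Variables (n N : nat) (PTheta : @Defs.code X Y S n N -> R).
Hypotheses (N0 : (0 < N)%N) (hTheta : is_pmf PTheta).

Local Notation V := ('I_N * @Defs.code X Y S n N)%type.
Local Notation Omega := (V * word n S * word n Y)%type.
Implicit Types (Qs : 'I_n -> S -> J -> R) (w : Omega).

Definition prior (v : V) : R := PTheta v.2 / N%:R.

Definition sent (v : V) (s : word n S) : word n X := v.2.1 (v.1, s).

(** The jammer of the converse applies [Qs k] to the letter [s k] alone and ignores the message. Its
    letters are averaged out, and the message is uniform. *)
Definition process Qs w : R := let: (v, s, y) := w in
  prior v * iid PS s * prodw (fun k => averaged W (Qs k) (sent v s k) (s k)) y.

Let NR0 : 0 < N%:R :> R. Proof. by rewrite ltr0n. Qed.

Lemma prior_pmf : is_pmf prior.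
Proof.
have [T0 T1] := hTheta; split=> [v|]; first by rewrite divr_ge0.
rewrite -(pair_bigA _ (fun m th => prior (m, th)))/=.
rewrite exchange_big -[RHS]T1; apply: eq_bigr => th _.
rewrite /prior/= sumr_const card_ord -[(_ / _) *+ N]mulr_natl mulrCA.
by rewrite mulfV ?mulr1// gt_eqF.
Qed.

Let prior0 v : 0 <= prior v. Proof. by have [] := prior_pmf. Qed.
Let iid0 s : 0 <= iid PS (n := n) s.
Proof. by apply: prodr_ge0 => k _; exact: ltW. Qed.

Lemma iid_pmf : is_pmf (@iid R S PS n).
Proof. exact: (@is_pmf_prodw _ _ _ (fun=> PS)). Qed.

Lemma process_sum Qs (F : Omega -> R) : \sum_w process Qs w * F w =
  \sum_v \sum_s prior v * iid PS s * \sum_y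
    prodw (fun k => averaged W (Qs k) (sent v s k) (s k)) y * F (v, s, y).
Proof.
transitivity (\sum_v \sum_s \sum_y process Qs (v, s, y) * F (v, s, y)).
  by rewrite !pair_bigA; apply: eq_bigr => -[[v s] y] _.
apply: eq_bigr => v _; apply: eq_bigr => s _; rewrite mulr_sumr.
by apply: eq_bigr => y _; rewrite /process mulrA.
Qed.

Section GivenJamming.
Variable Qs : 'I_n -> S -> J -> R.
Hypothesis hQs : forall i, is_cond_pmf (Qs i).

Lemma averaged_word_pmf v s :
  forall k, is_pmf (averaged W (Qs k) (sent v s k) (s k)).
Proof. by move=> k; exact: averaged_pmf. Qed.

Lemma process_ge0 w : 0 <= process Qs w.
Proof.
case: w => -[v s] y; rewrite /process; apply: mulr_ge0.
  by apply: mulr_ge0; [exact: prior0|exact: iid0].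
by apply: prodw_ge0 => k b; have [] := averaged_word_pmf v s k.
Qed.

Lemma process_vs (F : V -> word n S -> R) :
  \sum_w process Qs w * F w.1.1 w.1.2 = \sum_v \sum_s prior v * iid PS s * F v s.
Proof.
rewrite (process_sum Qs (fun w => F w.1.1 w.1.2)).
apply: eq_bigr => v _; apply: eq_bigr => s _ /=.
rewrite -mulr_suml sum_prodw1 ?mul1r//; exact: averaged_word_pmf.
Qed.

Lemma sum_process : \sum_w process Qs w = 1.
Proof.
have [_ <-] := prior_pmf; have [_ i1] := iid_pmf.
have := process_vs (fun _ _ => 1); under eq_bigr do rewrite mulr1.
move=> ->; apply: eq_bigr => v _.
by under eq_bigr do rewrite mulr1; rewrite -mulr_sumr i1 mulr1.
Qed.

Lemma process_change Qs' i (F : Omega -> R) :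
  (forall k, is_cond_pmf (Qs' k)) -> (forall k, k != i -> Qs' k = Qs k) ->
  (forall v s y b, F (v, s, update y i b) = F (v, s, y)) ->
  \sum_w process Qs' w * F w = \sum_w process Qs w * F w.
Proof.
move=> hQs' QQ' hF; rewrite !process_sum.
apply: eq_bigr => v _; apply: eq_bigr => s _; congr (_ * _).
apply: (@prodw_change _ _ _ _ _ i) => // [k ki||].
- by rewrite QQ'.
- by have [] := averaged_pmf hW (sent v s i) (s i) (hQs i).
- by have [] := averaged_pmf hW (sent v s i) (s i) (hQs' i).
Qed.

Lemma process_output i (F : Omega -> R) (g : Y -> R) :
  (forall v s y b, F (v, s, update y i b) = F (v, s, y)) ->
  \sum_w process Qs w * (F w * g (w.2 i)) =
  \sum_w process Qs w * (F w * \sum_b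
    averaged W (Qs i) (sent w.1.1 w.1.2 i) (w.1.2 i) b * g b).
Proof.
move=> hF; rewrite (process_sum Qs (fun w => F w * g (w.2 i))).
rewrite (process_sum Qs (fun w => F w * \sum_b
    averaged W (Qs i) (sent w.1.1 w.1.2 i) (w.1.2 i) b * g b)).
apply: eq_bigr => v _; apply: eq_bigr => s _; congr (_ * _).
rewrite (prodw_indep (i := i) (F := fun y => F (v, s, y))) => [|//|y b]; last 2 first.
- by have [] := averaged_word_pmf v s i.
- exact: hF.
by rewrite mulr_suml; apply: eq_bigr => y _; rewrite mulrA.
Qed.

End GivenJamming.

(** Interpolates between the state vector at [i = 0] and the output vector at [i = n]. *)
Definition hybrid (i : nat) w : {ffun 'I_n -> Y + S} :=
  [ffun k : 'I_n => if (k < i)%N then inl (w.2 k) else inr (w.1.2 k)].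

(* The auxiliary variable of letter [i]: message, code, past outputs and
   future states. *)
Definition auxiliary (i : 'I_n) w : V * {ffun 'I_n -> option (Y + S)} :=
  (w.1.1, [ffun k => if k == i then None else Some (hybrid i w k)]).

Lemma auxiliary_update i w b : auxiliary i (w.1, update w.2 i b) = auxiliary i w.
Proof.
rewrite /auxiliary; congr pair; apply/ffunP => k; rewrite !ffunE /=.
by case: eqP.
Qed.

Lemma auxiliary_update_later (i k : 'I_n) w b : (i < k)%N ->
  auxiliary i (w.1, update w.2 k b) = auxiliary i w.
Proof.
move=> ik; rewrite /auxiliary; congr pair; apply/ffunP => l; rewrite !ffunE /=.
case: eqP => // _; case: ifP => // li.
by case: eqP => // lk; move: li; rewrite lk ltnNge ltnW.
Qed.

(** Filling the hole of [auxiliary i] with the state gives [hybrid i], with the output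
    [hybrid i.+1]. The joint entropies are thus consecutive terms of one sequence, which takes the
    place of the Csiszár sum identity. *)
Lemma auxiliary_state i w w' :
  ((auxiliary i w, w.1.2 i) == (auxiliary i w', w'.1.2 i)) =
  ((w.1.1, hybrid i w) == (w'.1.1, hybrid i w')).
Proof.
rewrite !xpair_eqE /=; case: eqP => //= _; apply/andP/eqP.
  move=> [/eqP/ffunP H /eqP si]; apply/ffunP => k; have := H k; rewrite !ffunE.
  by case: eqP => [->|_ [//]]; rewrite ltnn si.
move=> /ffunP H; split.
  by apply/eqP/ffunP => k; have := H k; rewrite !ffunE; case: eqP => // _ ->.
by have := H i; rewrite !ffunE ltnn => -[->].
Qed.

Lemma auxiliary_output i w w' :
  ((auxiliary i w, w.2 i) == (auxiliary i w', w'.2 i)) =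
  ((w.1.1, hybrid i.+1 w) == (w'.1.1, hybrid i.+1 w')).
Proof.
rewrite !xpair_eqE /=; case: eqP => //= _; apply/andP/eqP.
  move=> [/eqP/ffunP H /eqP si]; apply/ffunP => k; have := H k; rewrite !ffunE.
  case: eqP => [->|/eqP ki [//]]; first by rewrite ltnSn si.
  by rewrite ltnS [(k <= i)%N]leq_eqVlt (negbTE (ki : (k : nat) != i)).
move=> /ffunP H; split.
  apply/eqP/ffunP => k; have := H k; rewrite !ffunE; case: eqP => // /eqP ki.
  by rewrite ltnS [(k <= i)%N]leq_eqVlt (negbTE (ki : (k : nat) != i)) => ->.
by have := H i; rewrite !ffunE ltnSn => -[->].
Qed.

Definition letter_law Qs i u s x : R :=
  law (process Qs) (fun w => (auxiliary i w, w.1.2 i, sent w.1.1 w.1.2 i)) (u, s, x).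

Definition letter_gap Qs i : R :=
  info_gap (fun u s => \sum_x letter_law Qs i u s x)
    (fun u y => \sum_s \sum_x letter_law Qs i u s x * averaged W (Qs i) x s y).

Lemma sum_letter_law Qs i u s : \sum_x letter_law Qs i u s x =
  law (process Qs) (fun w => (auxiliary i w, w.1.2 i)) (u, s).
Proof.
rewrite /letter_law; under eq_bigr do rewrite lawE.
rewrite exchange_big lawE; apply: eq_bigr => w _ /=.
rewrite -mulr_sumr; congr (_ * _); set x' := sent _ _ _.
rewrite (bigD1 x')//= [X in _ + X]big1 ?addr0; first by rewrite xpair_eqE eqxx andbT.
by move=> x /negbTE xx'; rewrite xpair_eqE [x' == x]eq_sym xx' andbF.
Qed.

(** [U_i] omits the output [i] and all later ones, so even the case [k = i] is harmless. *)
Lemma letter_law_change Qs Qs' (i k : 'I_n) : (i <= k)%N ->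
  (forall l, is_cond_pmf (Qs l)) -> (forall l, is_cond_pmf (Qs' l)) ->
  (forall l, l != k -> Qs' l = Qs l) -> letter_law Qs' i = letter_law Qs i.
Proof.
move=> ik hQs hQs' QQ'; apply/funext => u; apply/funext => s; apply/funext => x.
rewrite /letter_law !lawE.
pose F w : R := ((auxiliary i w, w.1.2 i, sent w.1.1 w.1.2 i) == (u, s, x))%:R.
have FE v s' y b : F (v, s', update y k b) = F (v, s', y).
  congr (nat_of_bool (_ == _))%:R; congr (_, _, _).
  move: ik; rewrite leq_eqVlt => /predU1P[/val_inj ->|ik].
    exact: (auxiliary_update k (v, s', y)).
  exact: (auxiliary_update_later (v, s', y) b ik).
exact: (process_change hQs hQs' QQ' FE).
Qed.

Section Bounds.
Variable Qs : 'I_n -> S -> J -> R.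
Hypothesis hQs : forall i, is_cond_pmf (Qs i).
Local Notation P := (process Qs).

Lemma law_state i s : law P (fun w => w.1.2 i) s = PS s.
Proof.
rewrite lawE (process_vs hQs (fun _ s' => (s' i == s)%:R)).
have [_ v1] := prior_pmf.
have cst_v z : z = \sum_v prior v * z by rewrite -mulr_suml v1 mul1r.
rewrite [RHS]cst_v.
apply: eq_bigr => v _.
under eq_bigr do rewrite -mulrA.
rewrite -mulr_sumr; congr (_ * _).
transitivity (\sum_b PS b * (b == s)%:R).
  apply: (prodw_marginal (p := fun _ : 'I_n => PS) i (fun b => (b == s)%:R)).
  by move=> k; have [] := hPS.
rewrite (bigD1 s)//= eqxx mulr1 [X in _ + X]big1 ?addr0//.
by move=> b /negbTE ->; rewrite mulr0.
Qed.

Lemma law_message_states v s : law P (fun w => (w.1.1, w.1.2)) (v, s) =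
  prior v * iid PS s.
Proof.
rewrite lawE (process_vs hQs (fun v' s' => ((v', s') == (v, s))%:R)).
rewrite (bigD1 v)//= [X in _ + X]big1 ?addr0; last first.
  move=> v' /negbTE vE; rewrite big1// => s' _.
  by rewrite xpair_eqE vE mulr0.
rewrite (bigD1 s)//= eqxx mulr1 [X in _ + X]big1 ?addr0// => s' /negbTE sE.
by rewrite xpair_eqE sE andbF mulr0.
Qed.

(** The Markov chain [U_i - (X_i, S_i) - Y_i]: the jammer's kernel sees [S_i] only. *)
Lemma law_auxiliary_output i u y :
  \sum_s \sum_x letter_law Qs i u s x * averaged W (Qs i) x s y =
  law P (fun w => (auxiliary i w, w.2 i)) (u, y).
Proof.
rewrite lawE.
rewrite (eq_bigr (fun w => P w * ((auxiliary i w == u)%:R * (w.2 i == y)%:R))).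
  rewrite (@process_output Qs hQs i (fun w => (auxiliary i w == u)%:R)
    (fun b => (b == y)%:R)); last first.
    by move=> v s y' b; rewrite (auxiliary_update i (v, s, y')).
  have /= SL := sum_law P (fun w => (auxiliary i w, w.1.2 i, sent w.1.1 w.1.2 i))
    (fun usx => (usx.1.1 == u)%:R * averaged W (Qs i) usx.2 usx.1.2 y).
  rewrite [RHS](_ : _ = \sum_t P t * ((auxiliary i t == u)%:R *
    averaged W (Qs i) (sent t.1.1 t.1.2 i) (t.1.2 i) y)); last first.
    apply: eq_bigr => w _; congr (_ * (_ * _)); rewrite (bigD1 y)//= eqxx mulr1.
    by rewrite [X in _ + X]big1 ?addr0// => b /negbTE ->; rewrite mulr0.
  rewrite SL [RHS](_ : _ = \sum_u' \sum_s \sum_x letter_law Qs i u' s x *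
    ((u' == u)%:R * averaged W (Qs i) x s y)); last first.
    by rewrite !pair_bigA; apply: eq_bigr => -[[]].
  rewrite [RHS](bigD1 u)//= [X in _ = _ + X]big1 ?addr0.
    by apply: eq_bigr => s _; apply: eq_bigr => x _; rewrite eqxx mul1r.
  move=> u' /negbTE uE; rewrite big1// => s _; rewrite big1// => x _.
  by rewrite uE mul0r mulr0.
by move=> w _; rewrite xpair_eqE; case: eqP => _; case: eqP => _;
  rewrite ?mulr1 ?mulr0.
Qed.

Lemma letter_gapE i : letter_gap Qs i = \sum_w P w *
  (ln (law P (fun w => (w.1.1, hybrid i.+1 w)) (w.1.1, hybrid i.+1 w))
   - ln (law P (fun w => (w.1.1, hybrid i w)) (w.1.1, hybrid i w))
   - ln (law P (fun w => w.2 i) (w.2 i)) + ln (PS (w.1.2 i))).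
Proof.
rewrite /letter_gap [X in info_gap X _](_ : _ = fun u s =>
  law P (fun w => (auxiliary i w, w.1.2 i)) (u, s)); last first.
  by apply/funext => u; apply/funext => s; rewrite sum_letter_law.
rewrite [X in info_gap _ X](_ : _ = fun u y =>
  law P (fun w => (auxiliary i w, w.2 i)) (u, y)); last first.
  by apply/funext => u; apply/funext => y; rewrite law_auxiliary_output.
rewrite info_gap_law; apply: eq_bigr => w _; rewrite law_state.
rewrite (law_same P (f := fun w => (auxiliary i w, w.1.2 i))
  (g := fun w => (w.1.1, hybrid i w)) (t := w)); last first.
  by move=> w'; exact: auxiliary_state.
rewrite (law_same P (f := fun w => (auxiliary i w, w.2 i))
  (g := fun w => (w.1.1, hybrid i.+1 w)) (t := w)); last first.
  by move=> w'; exact: auxiliary_output.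
by congr (_ * _); ring.
Qed.

Definition product_output (y : word n Y) : R :=
  prodw (fun i b => law P (fun w => w.2 i) b) y.

(** The law of the states in [T 0] cancels the terms [ln (PS _)]. What remains is the divergence of
    the law of [(V, Y^n)] from [prior] times the product of the output marginals. *)
Lemma sum_letter_gap : \sum_i letter_gap Qs i = \sum_w P w *
  (ln (law P (fun w => (w.1.1, w.2)) (w.1.1, w.2))
   - ln (prior w.1.1) - ln (product_output w.2)).
Proof.
under eq_bigr do rewrite letter_gapE.
rewrite exchange_big; apply: eq_bigr => w _; rewrite -mulr_sumr /=.
have := process_ge0 hQs w; rewrite le_eqVlt => /predU1P[<- | Pw].
  by rewrite !mul0r.
congr (_ * _).
rewrite big_split/= sumrB.
pose T i := ln (law P (fun w => (w.1.1, hybrid i w)) (w.1.1, hybrid i w)).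
have -> : \sum_(i < n) (ln (law P (fun w => (w.1.1, hybrid i.+1 w))
      (w.1.1, hybrid i.+1 w)) -
    ln (law P (fun w => (w.1.1, hybrid i w)) (w.1.1, hybrid i w))) = T n - T 0%N.
  by rewrite -(telescope_sumr T (leq0n n)) big_mkord.
have -> : T n = ln (law P (fun w => (w.1.1, w.2)) (w.1.1, w.2)).
  congr ln; apply: law_same => w'; rewrite !xpair_eqE; congr (_ && _).
  apply/eqP/eqP => [/ffunP H|yE]; apply/ffunP => k.
    by have := H k; rewrite !ffunE ltn_ord => -[].
  by rewrite !ffunE yE ltn_ord.
have -> : T 0%N = ln (prior w.1.1 * iid PS w.1.2).
  rewrite -law_message_states; congr ln; apply: law_same => w'.
  rewrite !xpair_eqE; congr (_ && _).
  apply/eqP/eqP => [/ffunP H|yE]; apply/ffunP => k.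
    by have := H k; rewrite !ffunE ltn0 => -[].
  by rewrite !ffunE yE ltn0.
have iid_gt0 : 0 < iid PS w.1.2 by apply: prodr_gt0 => k _.
have pr_gt0 : 0 < prior w.1.1.
  rewrite lt_def prior0 andbT; apply/eqP => v0; move: Pw.
  by case: (w) v0 => -[v s] y /= ->; rewrite !mul0r ltxx.
have Yi i : 0 < law P (fun w => w.2 i) (w.2 i).
  exact: (law_gt0 (process_ge0 hQs) (fun w => w.2 i) Pw).
rewrite lnM ?posrE// /product_output /prodw /iid.
have ln_prod (F : 'I_n -> R) : (forall k, 0 < F k) ->
    ln (\prod_k F k) = \sum_k ln (F k).
  move=> F0; rewrite -[RHS]expRK expR_sum; congr ln; apply: eq_bigr => k _.
  by rewrite lnK ?posrE.
by rewrite !ln_prod//; ring.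
Qed.

Definition process_error : R :=
  \sum_(w : Omega | w.1.1.2.2 w.2 != Some w.1.1.1) P w.

(* Gibbs' inequality against the guess that gives weight [1 - e] to the decoded
   message and [e / N] to every message, which replaces Fano's inequality. *)
Lemma fano_gap (e : R) : 0 < e < 1 ->
  (1 - process_error) * (ln N%:R + ln (1 - e)) + process_error * ln e <=
  \sum_i letter_gap Qs i.
Proof.
move=> /andP[e0 e1]; have e1' : 0 < 1 - e by rewrite subr_gt0.
pose ok w : bool := w.1.1.2.2 w.2 == Some w.1.1.1.
pose K (v : V) (y : word n Y) : R :=
  (1 - e) * (v.2.2 y == Some v.1)%:R + e / N%:R.
have eN : 0 < e / N%:R by rewrite divr_gt0.
have K0 v y : 0 < K v y by rewrite ltr_wpDl// mulr_ge0// ltW.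
have Ksum th y : \sum_m K (m, th) y <= 1.
  rewrite big_split/= sumr_const card_ord -[(_ / _) *+ N]mulr_natl mulrCA.
  rewrite mulfV ?gt_eqF// mulr1.
  rewrite -mulr_sumr -lerBrDr ler_piMr ?(ltW e1')//.
  case: (th.2 y) => [m|].
    rewrite (bigD1 m)//= eqxx [X in _ + X]big1 ?addr0//.
    by move=> m' /negbTE mE; rewrite (inj_eq Some_inj) eq_sym mE.
  by rewrite big1.
have P0 := process_ge0 hQs.
have PY0 y : 0 <= product_output y.
  by apply: prodw_ge0 => k b; exact: law_ge0.
have PY1 : \sum_y product_output y = 1.
  rewrite sum_prodw big1// => k _.
  by rewrite (sum_lawT P (fun w => w.2 k)) sum_process.
pose L v y := law P (fun w => (w.1.1, w.2)) (v, y).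
have L0 v y : 0 <= L v y by exact: law_ge0.
have Lw w : 0 < P w -> 0 < L w.1.1 w.2.
  exact: (law_gt0 P0 (fun w => (w.1.1, w.2))).
have pr_gt0 w : 0 < P w -> 0 < prior w.1.1.
  move=> Pw; rewrite lt_def prior0 andbT; apply/eqP => v0; move: Pw.
  by case: (w) v0 => -[v s] y /= ->; rewrite !mul0r ltxx.
have PYw w : 0 < P w -> 0 < product_output w.2.
  by move=> Pw; apply: prodr_gt0 => i _; exact: (law_gt0 P0 (fun w => w.2 i) Pw).
(* [prior * N] is the law of the code: the numerator is the sub-probability in which code and output
   are independent and the message is guessed by [K]. *)
pose r v y := prior v * product_output y * (N%:R * K v y) / L v y.
have G : \sum_w P w * ln (r w.1.1 w.2) <= 0.
  apply: gibbs => // [w Pw|].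
    apply: divr_gt0; last exact: Lw.
    apply: mulr_gt0; last exact: mulr_gt0.
    by apply: mulr_gt0; [exact: pr_gt0|exact: PYw].
  rewrite [leRHS](sum_process hQs).
  rewrite (sum_law P (fun w => (w.1.1, w.2)) (fun vy => r vy.1 vy.2)).
  apply: (@le_trans _ _ (\sum_v \sum_y prior v * product_output y * (N%:R * K v y))).
    rewrite pair_bigA/=; apply: ler_sum => -[v y] _ /=; rewrite -/(L v y) /r.
    have [->|Lvy] := eqVneq (L v y) 0.
      rewrite mul0r; apply: mulr_ge0; first exact: mulr_ge0.
      by apply: mulr_ge0; [exact: ler0n|exact: ltW].
    by rewrite mulrC divfK.
  rewrite -(pair_bigA _ (fun m th => \sum_y prior (m, th) * product_output y *
    (N%:R * K (m, th) y)))/= exchange_big/=.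
  have [T0 T1] := hTheta.
  have cst_y z : z = \sum_y z * product_output y.
    by rewrite -mulr_sumr PY1 mulr1.
  rewrite -[leRHS]T1; apply: ler_sum => th _; rewrite exchange_big/=.
  rewrite [leRHS]cst_y; apply: ler_sum => y _.
  rewrite (_ : \sum_m _ = PTheta th * product_output y * \sum_m K (m, th) y).
    by rewrite ler_piMr// mulr_ge0.
  rewrite mulr_sumr; apply: eq_bigr => m _; rewrite /prior/=; field.
  by rewrite gt_eqF.
apply: (@le_trans _ _ (\sum_w P w * ln (N%:R * K w.1.1 w.2))); last first.
  rewrite sum_letter_gap -subr_le0 -sumrB; apply: le_trans G.
  rewrite le_eqVlt; apply/orP; left; apply/eqP; apply: eq_bigr => w _.
  have := P0 w; rewrite le_eqVlt => /predU1P[<- | Pw].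
    by rewrite !mul0r subr0.
  have [p1 p2 p3 p4] := And4 (pr_gt0 w Pw) (PYw w Pw) (Lw w Pw) (K0 w.1.1 w.2).
  have p5 : 0 < N%:R * K w.1.1 w.2 by rewrite mulr_gt0.
  have p6 : 0 < prior w.1.1 * product_output w.2 by exact: mulr_gt0.
  have p7 : 0 < prior w.1.1 * product_output w.2 * (N%:R * K w.1.1 w.2).
    exact: mulr_gt0.
  rewrite /r ln_div ?posrE//.
  rewrite [ln (_ * (N%:R * _))]lnM ?posrE//.
  by rewrite [ln (prior _ * _)]lnM ?posrE// -/(L w.1.1 w.2); ring.
have good : \sum_(w | ok w) P w = 1 - process_error.
  apply: (addIr process_error); rewrite subrK -[RHS](sum_process hQs).
  by rewrite [RHS](bigID ok).
rewrite -good /process_error [leRHS](bigID ok)/= !mulr_suml; apply: lerD.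
  apply: ler_sum => w okw; apply: ler_wpM2l => //.
  rewrite -lnM ?posrE// ler_ln ?posrE ?mulr_gt0// ler_pM2l//.
  by rewrite /K -/(ok w) okw mulr1 lerDl ltW.
apply: ler_sum => w okw; apply: ler_wpM2l => //.
have okF : ok w = false by exact/negbTE.
rewrite /K -/(ok w) okF mulr0 add0r mulrCA divff ?gt_eqF// mulr1.
exact: lexx.
Qed.

End Bounds.

Lemma adaptive_jamming (C : R) :
  (forall (U : finType) (q : U -> S -> X -> R),
    (forall u s x, 0 <= q u s x) -> (forall s, \sum_u \sum_x q u s x = PS s) ->
    exists2 Q, is_cond_pmf Q & info_gap (fun u s => \sum_x q u s x)
      (fun u y => \sum_s \sum_x q u s x * averaged W Q x s y) <= C) ->
  exists Qs : 'I_n -> S -> J -> R,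
    (forall i, is_cond_pmf (Qs i)) /\ \sum_i letter_gap Qs i <= n%:R * C.
Proof.
move=> HC.
suff /(_ n (leqnn n))[Qs [hQs QsC]] : forall k, (k <= n)%N ->
    exists Qs : 'I_n -> S -> J -> R, (forall i, is_cond_pmf (Qs i)) /\
      forall i : 'I_n, (i < k)%N -> letter_gap Qs i <= C.
  exists Qs; split => //; apply: (@le_trans _ _ (\sum_(i < n) C)).
    by apply: ler_sum => i _; exact: QsC.
  by rewrite sumr_const card_ord mulr_natl.
elim=> [_|k IH kn].
  (* Letters not yet treated hold an arbitrary kernel, replaced when their turn comes. *)
  have [j0 _] := card_gt0P hJ; exists (fun _ _ j => (j == j0)%:R); split => //.
  by move=> i s; exact: dirac_pmf.
have [Qs [hQs QsC]] := IH (ltnW kn).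
pose ik := Ordinal kn.
have [||Q hQ QC] := HC _ (letter_law Qs ik).
- by move=> u s x; apply: law_ge0; exact: process_ge0.
- move=> s; under eq_bigr do rewrite sum_letter_law.
  rewrite (law_pair_suml (process Qs) (auxiliary ik) (fun w => w.1.2 ik)).
  exact: law_state.
pose Qs' l := if l == ik then Q else Qs l.
have hQs' l : is_cond_pmf (Qs' l) by rewrite /Qs'; case: eqP.
have QQ' l : l != ik -> Qs' l = Qs l by rewrite /Qs' => /negbTE ->.
exists Qs'; split => // i; rewrite ltnS leq_eqVlt => /predU1P[ik'|ltik].
  have -> : i = ik by exact: val_inj.
  rewrite /letter_gap (letter_law_change (leqnn ik) hQs hQs' QQ').
  by rewrite {1}/Qs' eqxx.
rewrite /letter_gap (letter_law_change (ltnW ltik : (i <= ik)%N) hQs hQs' QQ').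
by rewrite QQ'; [exact: QsC|rewrite -(inj_eq val_inj) neq_ltn ltik].
Qed.

Definition product_jamming Qs (s : word n S) (j : word n J) : R :=
  prodw (fun k => Qs k (s k)) j.

Lemma product_jamming_pmf Qs : (forall i, is_cond_pmf (Qs i)) ->
  is_cond_pmf (product_jamming Qs).
Proof. by move=> hQs s; apply: is_pmf_prodw => k; exact: hQs. Qed.

Lemma product_jamming_output Qs x s y :
  \sum_j product_jamming Qs s j * memoryless W x s j y =
  prodw (fun k => averaged W (Qs k) (x k) (s k)) y.
Proof.
rewrite /prodw /averaged bigA_distr_bigA; apply: eq_bigr => j _.
by rewrite -big_split.
Qed.

Lemma process_errorE Qs : process_error Qs =
  \sum_m error_prob PS W PTheta m (product_jamming Qs) / N%:R.
Proof.
rewrite /process_error big_mkcond/=.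
transitivity (\sum_(m < N) \sum_(th : @Defs.code X Y S n N)
  \sum_(s : word n S) \sum_(y : word n Y)
  (if th.2 y != Some m then process Qs (m, th, s, y) else 0)).
  by rewrite !pair_bigA; apply: eq_bigr => -[[[m th] s] y].
apply: eq_bigr => m _; rewrite error_probE mulr_suml; apply: eq_bigr => th _.
rewrite mulr_sumr mulr_suml; apply: eq_bigr => s _.
rewrite [X in _ = _ * (_ * X) * _](_ : _ = \sum_(y | th.2 y != Some m)
    prodw (fun k => averaged W (Qs k) (th.1 (m, s) k) (s k)) y); last first.
  under eq_bigr do rewrite mulr_sumr.
  rewrite exchange_big/=; apply: eq_bigr => y _; exact: product_jamming_output.
rewrite -big_mkcond !mulr_sumr mulr_suml; apply: eq_bigr => y _.
by rewrite /process /prior /sent/=; ring.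
Qed.

(** Bounds the set defining [max_error_prob], so that its [sup] is an upper bound. *)
Lemma error_prob_le1 m Q : is_cond_pmf Q -> error_prob PS W PTheta m Q <= 1.
Proof.
move=> hQ; rewrite error_probE; have [T0 T1] := hTheta.
have [i0 i1] := iid_pmf.
have w1 x s j : \sum_(y : word n Y) memoryless W x s j y = 1.
  by apply: (@sum_prodw1 _ _ _ (fun i => W (x i, s i, j i))) => k; exact: hW.
have w0 x s j y : 0 <= memoryless W x s j y :> R.
  by apply: prodr_ge0 => k _; have [] := hW (x k, s k, j k).
rewrite -[leRHS]T1; apply: ler_sum => th _; rewrite ler_piMr//.
rewrite -[leRHS]i1; apply: ler_sum => s _; rewrite ler_piMr//.
have [Q0 Q1] := hQ s.
rewrite -[leRHS]Q1; apply: ler_sum => j _; rewrite ler_piMr//.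
rewrite -(w1 (th.1 (m, s)) s j).
by rewrite [leRHS](bigID (fun y => th.2 y != Some m))/= lerDl sumr_ge0.
Qed.

Lemma process_error_le Qs : (forall i, is_cond_pmf (Qs i)) ->
  process_error Qs <= max_error_prob PS W PTheta.
Proof.
move=> hQs; rewrite process_errorE -mulr_suml ler_pdivrMr//.
apply: (@le_trans _ _ (\sum_(m < N) max_error_prob PS W PTheta)); last first.
  by rewrite sumr_const card_ord mulr_natr.
apply: ler_sum => m _; apply: ub_le_sup.
  by exists 1 => _ [m' [Q [hQ ->]]]; exact: error_prob_le1.
by exists m, (product_jamming Qs); split => //; exact: product_jamming_pmf.
Qed.

Lemma process_error_ge0 Qs : (forall i, is_cond_pmf (Qs i)) -> 0 <= process_error Qs.
Proof. by move=> hQs; apply: sumr_ge0 => w _; exact: process_ge0. Qed.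

End Converse.

(** * Capacity *)

Section Capacity.
Context {R : realType} {X Y S J : finType}.
Variables (PS : S -> R) (W : X * S * J -> Y -> R).
Hypotheses (hX : (0 < #|X|)%N) (hJ : (0 < #|J|)%N).
Hypotheses (hPS : is_pmf PS) (PS0 : forall s, 0 < PS s) (hW : is_cond_pmf W).

Let powR2E (x : R) : 2 `^ x = expR (x * ln 2).
Proof. by rewrite /powR pnatr_eq0. Qed.

Lemma achievable_le (C r : R) :
  (forall (U : finType) (q : U -> S -> X -> R),
    (forall u s x, 0 <= q u s x) -> (forall s, \sum_u \sum_x q u s x = PS s) ->
    exists2 Q, is_cond_pmf Q & info_gap (fun u s => \sum_x q u s x)
      (fun u y => \sum_s \sum_x q u s x * averaged W Q x s y) <= C * ln 2) ->
  achievable PS W r -> r <= C.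
Proof.
move=> HC ach; rewrite leNgt; apply/negP => Cr.
have ln20 := ln2_gt0 (R := R).
pose g := (r - C) * ln 2.
have g0 : 0 < g by rewrite mulr_gt0// subr_gt0.
have g4 : 0 < g / 4 by rewrite divr_gt0.
pose e := 1 - expR (- (g / 4)).
have e01 : 0 < e < 1.
  by rewrite subr_gt0 -[X in _ < X]expR0 ltr_expR oppr_lt0 g4/= ltrBlDr
    ltrDl expR_gt0.
have lne : ln (1 - e) = - (g / 4) by rewrite /e opprB addrC subrK expRK.
(* [B] dominates the constants that multiply the error probability; an error of [g / 4 / B] costs at
   most [g / 4] in each. [r] may be negative, hence the absolute value. *)
pose B := 1 + `|r * ln 2| + `|ln e|.
have B0 : 0 < B by rewrite !ltr_wpDr.
have eps0 : 0 < g / 4 / B by rewrite divr_gt0.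
have [n [N [P [n0 NE hP Perr]]]] := ach _ eps0.
have N0 : (0 < N)%N by rewrite -(ltr_nat R) NE powR_gt0.
have lnN : ln N%:R = n%:R * (r * ln 2) by rewrite NE ln_powR mulrA.
have [Qs [hQs QsC]] := adaptive_jamming hJ hPS PS0 hW N0 hP HC.
have fano := fano_gap hPS PS0 hW N0 hP hQs e01.
have pe_le := process_error_le hPS PS0 hW N0 hP hQs.
have pe0 := process_error_ge0 PS0 hW N0 hP hQs.
move: fano pe_le pe0; set pe := process_error _ _ _ _.
rewrite lnN lne => fano pe_le pe0.
have peB : pe * B <= g / 4.
  by rewrite -ler_pdivlMr// (le_trans pe_le)// ltW.
have n1 : 1 <= n%:R :> R by rewrite ler1n.
have r_abs : pe * (r * ln 2) <= pe * `|r * ln 2|.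
  by rewrite ler_wpM2l// ler_norm.
have e_abs : - (pe * `|ln e|) <= pe * ln e.
  by rewrite -mulrN ler_wpM2l// lerNl -normrN ler_norm.
have b1 : pe * `|r * ln 2| <= g / 4.
  apply: le_trans peB; apply: ler_wpM2l => //; rewrite /B -addrA addrCA lerDl.
  by rewrite addr_ge0.
have b2 : pe * `|ln e| <= g / 4.
  apply: le_trans peB; apply: ler_wpM2l => //; rewrite /B lerDr.
  by rewrite addr_ge0.
have nb1 : n%:R * (pe * (r * ln 2)) <= n%:R * (g / 4).
  by rewrite ler_wpM2l// (le_trans r_abs).
have ng : g <= n%:R * g by rewrite ler_peMl// ltW.
have peg : 0 <= pe * (g / 4) by rewrite mulr_ge0// ltW.
have gE : n%:R * (r * ln 2) - n%:R * (C * ln 2) = n%:R * g by rewrite /g; ring.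
(* The estimates leave [n g <= n g / 4 + g / 2], impossible for [n >= 1]. *)
have := le_trans fano QsC.
have -> : (1 - pe) * (n%:R * (r * ln 2) - g / 4) + pe * ln e =
  n%:R * (r * ln 2) - g / 4 - n%:R * (pe * (r * ln 2)) + pe * (g / 4) + pe * ln e.
  by ring.
have nb1' : n%:R * (g / 4) = n%:R * g / 4 by ring.
by lra.
Qed.

(** Makes every upper bound of the achievable rates nonnegative, as [achievable_between]
    requires. *)
Lemma achievable0 : achievable PS W 0.
Proof.
have [x0 _] := card_gt0P hX; have [j0 _] := card_gt0P hJ.
move=> eps eps0; exists 1%N, 1%N.
pose th0 : @Defs.code X Y S 1 1 := ([ffun=> [ffun=> x0]], [ffun=> Some ord0]).
exists (fun th => (th == th0)%:R); split => //.
- by rewrite mulr0 powRr0.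
- exact: dirac_pmf.
have err m Q : error_prob PS W (fun th => (th == th0)%:R) m Q = 0.
  rewrite error_probE big1// => th _; have [->|_] := eqVneq th th0; last first.
    by rewrite mul0r.
  rewrite mul1r big1// => s _; rewrite big1 ?mulr0// => j _.
  by rewrite big_pred0 ?mulr0// => y; rewrite /th0/= ffunE [m]ord1 eqxx.
apply: le_lt_trans eps0; apply: ge_sup.
  exists 0, ord0, (fun _ j => (j == [ffun=> j0])%:R); split; last by rewrite err.
  by move=> s; exact: (@dirac_pmf R (word 1 J)).
by move=> _ [m [Q [_ ->]]]; rewrite err.
Qed.

(** As [2^(n r)] must be an integer, the rate is sought as [ln K / (k ln 2)]. If [k (C - b) > 1],
    the interval from [2^(k b)] to [2^(k C)] is longer than [1] and contains an integer [K]; powers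
    of [K] then serve block lengths that are multiples of [k]. *)
Lemma achievable_between (c : gp_input R X S) (b C : R) : 0 <= b -> b < C ->
  (forall Q, is_cond_pmf Q -> C <= gp_rate PS W c Q) ->
  exists2 r, b < r & achievable PS W r.
Proof.
move=> b0 bC hC.
have ln20 := ln2_gt0 (R := R).
pose k := (Num.truncn (C - b)^-1).+1.
have Cb : 0 < C - b by rewrite subr_gt0.
have kCb : 1 < k%:R * (C - b).
  rewrite -ltr_pdivrMr// mul1r; exact: truncnS_gt.
have kR : 0 < k%:R :> R by rewrite ltr0n.
pose K := (Num.truncn (2 `^ (k%:R * b) : R)).+1.
have Kb : 2 `^ (k%:R * b) < K%:R :> R by exact: truncnS_gt.
have pb1 : 1 <= 2 `^ (k%:R * b) :> R.
  by rewrite powR2E -[X in X <= _]expR0 ler_expR !mulr_ge0// ltW.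
have KC : K%:R < 2 `^ (k%:R * C) :> R.
  apply: (@le_lt_trans _ _ (2 `^ (k%:R * b) + 1)).
    by rewrite /K -natr1 lerD2r truncn_le ?powR_ge0.
  apply: (@le_lt_trans _ _ (2 `^ (k%:R * b) * 2)).
    by rewrite mulrDr mulr1 lerD2l.
  have -> : k%:R * C = k%:R * b + k%:R * (C - b) by ring.
  rewrite powRD ?pnatr_eq0 ?implybT// ltr_pM2l ?(lt_le_trans _ pb1)//.
  by rewrite powR2E -[X in X < _]lnK ?posrE// ltr_expR ltr_pMl.
have K0 : 0 < K%:R :> R by rewrite ltr0n.
pose r := ln K%:R / (k%:R * ln 2) : R.
have kln : 0 < k%:R * ln 2 :> R by rewrite mulr_gt0.
have br : b < r.
  rewrite ltr_pdivlMr// mulrA [b * _]mulrC -ln_powR ltr_ln ?posrE ?powR_gt0//.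
have rC : r < C.
  rewrite ltr_pdivrMr// mulrA [C * _]mulrC -ln_powR ltr_ln ?posrE ?powR_gt0//.
exists r => // eps eps0.
have [n0 hn0] := achievability hX hJ hPS PS0 hW rC hC eps0.
pose n := (k * n0.+1)%N; pose N := (K ^ n0.+1)%N.
have n0n : (n0 < n)%N by rewrite /n leq_pmull.
have NE : N%:R = 2 `^ (n%:R * r) :> R.
  rewrite powR2E /N natrX -[LHS]lnK ?posrE ?exprn_gt0// lnXn//; congr expR.
  rewrite /n natrM /r -mulr_natl; field.
  by rewrite !gt_eqF.
have [P [hP Perr]] := hn0 n N n0n NE.
by exists n, N, P; split => //; exact: leq_ltn_trans n0n.
Qed.

End Capacity.

Theorem theorem1 (R : realType) (X Y S J : finType)
    (hX : (0 < #|X|)%N) (hJ : (0 < #|J|)%N)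
    (PS : S -> R) (hPS : is_pmf PS) (hPS0 : forall s, 0 < PS s)
    (W : X * S * J -> Y -> R) (hW : is_cond_pmf W) :
  exists C : R,
    is_capacity PS W C /\
    is_maxmin [set Q : S -> J -> R | is_cond_pmf Q] (gp_rate PS W) C.
Proof.
have [C [maxmin HC]] := gp_maxmin hX hJ hPS hPS0 hW.
exists C; split => //; split=> [r|b bub]; first exact: achievable_le.
have [_ [[c [_ cC]] _]] := maxmin.
have b0 : 0 <= b by apply: bub; exact: achievable0.
rewrite leNgt; apply/negP => bC.
have [|r br ach] := achievable_between hX hJ hPS hPS0 hW b0 bC (c := c).
  by move=> Q hQ; apply: cC; exists Q.
by have := bub r ach; rewrite leNgt br.
Qed.
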